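(* Let $c_1=0$, $c_2=-1$, $c_3=-4$, $c_4=-1$. For $h=1,2,3,4$ we have $$N^{(h)}(q^2)=\frac{1}{2}\frac{q^{c_h}}{J_4}\big(\varphi(q)M^{(h)}(q)-(-1)^h\varphi(-q)M^{(h)}(-q)\big).$$ As a consequence, $$\sum_{i,j,k,l\geq 0}\frac{q^{2i^2+2j^2+k^2+l^2-2ij-2jk-kl-2i+2j-l}}{(q^2;q^2)_i(q^2;q^2)_j(q^2;q^2)_k(q^2;q^2)_l}=9\frac{J_3^3J_6^2}{J_1J_2^4}.$$
   Context: Throughout $0<|q|<1$. Notation: $(a;q)_n=\prod_{k=0}^{n-1}(1-aq^k)$, $(a;q)_\infty=\prod_{k\ge0}(1-aq^k)$; $J_m:=(q^m;q^m)_\infty$; $\varphi(q):=\sum_{n=-\infty}^\infty q^{n^2}$. Define $$N(u,v,w;q):=\sum_{i,j,k,l\geq 0}\frac{q^{2i^2+2j^2+k^2+l^2-2ij-2jk-kl}u^{i-j}v^kw^l}{(q^2;q^2)_i(q^2;q^2)_j(q^2;q^2)_k(q^2;q^2)_l}$$ and $N^{(1)}(q):=N(1,1,1;q)$, $N^{(2)}(q):=N(q^{-2},1,q^{-1};q)$, $N^{(3)}(q):=N(q^{-4},q^{-1},1;q)$, $N^{(4)}(q):=N(q^{-2},1,1;q)$. Define $$M(u,v,w;q):=\sum_{i,j,k\geq 0}\frac{q^{i^2+2j^2+2k^2-2ij-2jk}u^iv^jw^k}{(q^4;q^4)_i(q^4;q^4)_j(q^4;q^4)_k}$$ and $M^{(1)}(q):=M(1,1,1;q)$,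 $M^{(2)}(q):=M(q^2,q^{-2},1;q)$, $M^{(3)}(q):=M(q^2,1,q^{-2};q)$, $M^{(4)}(q):=M(q^2,1,1;q)$. *)

(* Defs.v *)
From HB Require Import structures.
From mathcomp Require Import all_boot all_order all_algebra finmap.
From mathcomp Require Import all_classical all_reals all_analysis.
Import Order.TTheory GRing.Theory Num.Theory numFieldNormedType.Exports.

Set Implicit Arguments.
Unset Strict Implicit.
Unset Printing Implicit Defensive.

Local Open Scope classical_set_scope.
Local Open Scope ring_scope.

(* Finite subsets of I directed by inclusion: "for all large enough A". *)
Definition fset_eventually (I : choiceType) : set_system {fset I} :=
  filter_from setT (fun A : {fset I} => [set B : {fset I} | (A `<=` B)%fset]).

Global Instance fset_eventually_filter (I : choiceType) :
  ProperFilter (@fset_eventually I).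
Proof.
apply: filter_from_proper; last by move=> A _; exists A; exact: fsubset_refl.
apply: filter_from_filter; first by exists fset0.
move=> A B _ _; exists (A `|` B)%fset => // D /=.
by rewrite fsubUset => /andP[].
Qed.

(* Unconditional sum of a family: the limit of its finite partial sums. It is
   the usual sum of an absolutely summable family, in any order of summation. *)
Definition usum (K : numFieldType) (I : choiceType) (f : I -> K) : K :=
  lim ((\sum_(x <- A) f x) @[A --> @fset_eventually I]).

Lemma usum_eq (K : numFieldType) (I : choiceType) (f : I -> K) (s : K) :
  (\sum_(x <- A) f x : K) @[A --> @fset_eventually I] --> s -> usum f = s.
Proof. by move=> fs; apply: cvg_lim => //; exact: norm_hausdorff. Qed.

Definition qpoch (K : numFieldType) (a q : K) (n : nat) : K :=
  \prod_(k < n) (1 - a * q ^+ k).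

Definition qpoch_inf (K : numFieldType) (a q : K) : K :=
  limn (fun n : nat => qpoch a q n).

Definition J (K : numFieldType) (m : nat) (q : K) : K :=
  qpoch_inf (q ^+ m) (q ^+ m).

Definition phi (K : numFieldType) (q : K) : K :=
  usum (fun n : int => q ^ (n ^+ 2)).

Definition N (K : numFieldType) (u v w q : K) : K :=
  usum (fun t : nat * nat * nat * nat => let: (i, j, k, l) := t in
    q ^ (2 * i%:Z ^+ 2 + 2 * j%:Z ^+ 2 + k%:Z ^+ 2 + l%:Z ^+ 2
         - 2 * i%:Z * j%:Z - 2 * j%:Z * k%:Z - k%:Z * l%:Z)
    * u ^ (i%:Z - j%:Z) * v ^+ k * w ^+ l
    / (qpoch (q ^+ 2) (q ^+ 2) i * qpoch (q ^+ 2) (q ^+ 2) j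
       * qpoch (q ^+ 2) (q ^+ 2) k * qpoch (q ^+ 2) (q ^+ 2) l)).

Definition M (K : numFieldType) (u v w q : K) : K :=
  usum (fun t : nat * nat * nat => let: (i, j, k) := t in
    q ^ (i%:Z ^+ 2 + 2 * j%:Z ^+ 2 + 2 * k%:Z ^+ 2
         - 2 * i%:Z * j%:Z - 2 * j%:Z * k%:Z)
    * u ^+ i * v ^+ j * w ^+ k
    / (qpoch (q ^+ 4) (q ^+ 4) i * qpoch (q ^+ 4) (q ^+ 4) j
       * qpoch (q ^+ 4) (q ^+ 4) k)).

(* In the three families below only the indices h = 1, 2, 3, 4 are meaningful;
   the value 0 for other h is a dummy. *)
Definition Nh (K : numFieldType) (h : nat) (q : K) : K :=
  match h with
  | 1%N => N 1 1 1 q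
  | 2%N => N (q ^- 2) 1 (q ^-1) q
  | 3%N => N (q ^- 4) (q ^-1) 1 q
  | 4%N => N (q ^- 2) 1 1 q
  | _ => 0
  end.

Definition Mh (K : numFieldType) (h : nat) (q : K) : K :=
  match h with
  | 1%N => M 1 1 1 q
  | 2%N => M (q ^+ 2) (q ^- 2) 1 q
  | 3%N => M (q ^+ 2) 1 (q ^- 2) q
  | 4%N => M (q ^+ 2) 1 1 q
  | _ => 0
  end.

Definition c (h : nat) : int :=
  match h with
  | 1%N => 0
  | 2%N => -1
  | 3%N => -4
  | 4%N => -1
  | _ => 0
  end.

(* Main.v *)
(* With p = q^4, the sum over i, j >= 0 with i - j = m fixed in N(q^2) is a shifted
   Durfee sum, and
     sum_b p^(b (b + m) - b k) / ((p)_b (p)_(b+m))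
       = 1/(p)_oo sum_n [k choose n]_p p^(m n - n (k - n))
   turns N(q^2) into 1/J_4 times a sum over m in Z and three indices >= 0. Its
   exponent contains 4m^2 + 4mi + i^2 = (2m + i)^2, so that it is the part of
   phi(q) M(q) in which the theta index and i have a prescribed relative parity.

   For the product formula, the exponent (i - j)^2 + (j - k)^2 + k^2 of M shows
   that M is obtained by applying three times the transform
     f |-> (j |-> q^(j^2) sum_i q^(i^2 - 2 i j) f_i / (p)_i).
   By the identity above, if f_i = sum_a [i choose a]_p B(2a - i), then the
   transform of f has, up to 1/(p)_oo, the same form with B convolved with the
   coefficients of theta(z) = sum_n q^(n^2) z^n. Now q M^(2) comes from
   f_i = 1 - p^i, for which Schur's finite pentagonal identity provides an
   explicit B; hence
     J_4^3 q M^(2) = sum_(x,y,t in Z) B(x + y + t) q^(x^2 + y^2 + t^2).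
   As B(s + 3) = - p^s B(s), translation by (1,1,1) factors this sum into
     sum_(x+y+t=1) q^(x^2+y^2+t^2) = 3 q J_6^3 / J_2
   (a consequence of the Jacobi triple product) and
     sum_n (-1)^n (q^(9n^2) + q^((3n+1)^2)),
   and the odd part of the product of the latter with phi(q) is 3 q J_12^2, by
   (k, n) = (a + b, a - b) and the pentagonal number theorem. Finally q is
   replaced by a square root of q. *)
Require Import Defs.
From HB Require Import structures.
From mathcomp Require Import all_boot all_order all_algebra finmap.
From mathcomp Require Import complex.
From mathcomp Require Import all_classical all_reals all_analysis.
From mathcomp Require Import ring lra zify.
Import Order.TTheory GRing.Theory Num.Theory numFieldNormedType.Exports.
Local Open Scope ring_scope.
Local Open Scope complex_scope.

Set Implicit Arguments.
Unset Strict Implicit.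
Unset Printing Implicit Defensive.

(** * Unconditional sums *)

(** [usum] is a limit operator with a default value on divergent families; this relation carries the
    convergence itself, with the limit as an argument. *)
Definition hsum (K : numFieldType) (I : choiceType) (f : I -> K) (s : K) :=
  forall e : K, 0 < e -> exists A : {fset I}, forall B : {fset I},
    (A `<=` B)%fset -> `|s - \sum_(x <- B) f x| < e.

Lemma hsum_usum (K : numFieldType) (I : choiceType) (f : I -> K) s :
  hsum f s -> usum f = s.
Proof.
move=> fs; apply: usum_eq; apply/cvgrPdist_lt => e e0.
by have [A HA] := fs e e0; exists A.
Qed.

Lemma fset_sum_le (D : numDomainType) (I : choiceType) (g : I -> D) (A B : {fset I}) :
  (forall x, 0 <= g x) -> (A `<=` B)%fset -> \sum_(x <- A) g x <= \sum_(x <- B) g x.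
Proof.
move=> g0 AB.
rewrite [leRHS](big_fsetID _ (fun x => x \in A)) /=.
have -> : [fset x in B | x \in A]%fset = A.
  apply/fsetP => x; rewrite !inE andbC; case: (boolP (x \in A)) => //= xA.
  by rewrite (fsubsetP AB).
by rewrite lerDl sumr_ge0.
Qed.

Section UnconditionalSums.
Context {R : realType}.
Local Notation K := R[i].
Implicit Types (I J : choiceType).

(** Absolute summability as a bound on finite sums. The order of [R[i]] relates only numbers with
    equal imaginary parts, but the empty sum gives 0 <= c, so the bound is real. *)
Definition asum I (f : I -> K) :=
  exists c : R[i], forall A : {fset I}, \sum_(x <- A) `|f x| <= c.

Lemma bounded_nonneg_sum I (g : I -> R) (c : R) : (forall x, 0 <= g x) ->
  (forall A : {fset I}, \sum_(x <- A) g x <= c) ->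
  exists s, forall e : R, 0 < e -> exists A : {fset I}, forall B : {fset I},
    (A `<=` B)%fset -> `|s - \sum_(x <- B) g x| < e.
Proof.
move=> g0 gc.
pose E : set R := [set y | exists A : {fset I}, y = \sum_(x <- A) g x]%classic.
have supE : has_sup E.
  split; first by exists 0, fset0; rewrite big_seq_fset0.
  by exists c => _ [A ->].
exists (sup E) => e e0.
have [_ [A ->] HA] := sup_adherent e0 supE.
exists A => B AB.
have B1 : \sum_(x <- B) g x <= sup E by apply: ub_le_sup; [exact: supE.2 | exists B].
have B2 := fset_sum_le g0 AB.
rewrite ger0_norm ?subr_ge0 //; lra.
Qed.

Lemma abs_bounded_real_sum I (g : I -> R) (c : R) :
  (forall A : {fset I}, \sum_(x <- A) `|g x| <= c) ->
  exists s, forall e : R, 0 < e -> exists A : {fset I}, forall B : {fset I},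
    (A `<=` B)%fset -> `|s - \sum_(x <- B) g x| < e.
Proof.
move=> gc.
have [|s1 H1] := @bounded_nonneg_sum I (fun x => `|g x|) c _ gc; first by [].
(* Signs are handled by g = (|g| + g) - |g|, a difference of two nonnegative families. *)
have [||s2 H2] := @bounded_nonneg_sum I (fun x => `|g x| + g x) (c + c).
- by move=> x; have := ler_norm (- g x); rewrite normrN; lra.
- move=> A; rewrite big_split /= lerD //; apply: le_trans (gc A).
  by apply: ler_sum => x _; exact: ler_norm.
exists (s2 - s1) => e e0.
have e2 : 0 < e / 2 by lra.
have [A1 HA1] := H1 _ e2; have [A2 HA2] := H2 _ e2.
exists (A1 `|` A2)%fset => B; rewrite fsubUset => /andP[B1 B2].
have := HA2 _ B2; have := HA1 _ B1; rewrite big_split /=.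
by rewrite !ltr_norml; lra.
Qed.

(** Real and imaginary parts are dominated by the absolute value, so each gives a convergent real
    family; the two limits are then recombined. *)
Lemma asum_hsum I (f : I -> K) : asum f -> hsum f (usum f).
Proof.
move=> [c fc].
have rc : (complex.Re c)%:C = c.
  apply: RRe_real; apply: (@ger0_real K).
  by have := fc fset0; rewrite big_seq_fset0.
have [|s1 H1] := @abs_bounded_real_sum I (fun x => complex.Re (f x)) (complex.Re c).
  move=> A; rewrite -lecR rc; apply: le_trans (fc A).
  rewrite rmorph_sum /=; apply: ler_sum => x _; exact: normc_ge_Re.
have normi : `|'i%C| = 1 :> K by rewrite normc_def /= expr0n /= add0r expr1n sqrtr1.
have imle (z : K) : `|complex.Im z|%:C <= `|z|.
  by have := normc_ge_Re (z * 'i%C); rewrite ReiNIm normrN normrM normi mulr1.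
have [|s2 H2] := @abs_bounded_real_sum I (fun x => complex.Im (f x)) (complex.Re c).
  move=> A; rewrite -lecR rc; apply: le_trans (fc A).
  by rewrite rmorph_sum /=; apply: ler_sum => x _; exact: imle.
suff H : hsum f (s1 +i* s2) by rewrite (hsum_usum H).
move=> e'; have [e ->] : exists e : R[i], e' = e by exists e'.
move=> e0.
have re : (complex.Re e)%:C = e by apply: RRe_real; apply: gtr0_real.
have e2 : 0 < complex.Re e / 2 by rewrite divr_gt0 // -ltcR re.
have [A1 HA1] := H1 _ e2; have [A2 HA2] := H2 _ e2.
exists (A1 `|` A2)%fset => B; rewrite fsubUset => /andP[B1 B2].
have h1 := HA1 _ B1; have h2 := HA2 _ B2.
set t := \sum_(x <- B) f x.
have t1 : complex.Re t = \sum_(x <- B) complex.Re (f x) by rewrite /t raddf_sum.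
have t2 : complex.Im t = \sum_(x <- B) complex.Im (f x).
  by rewrite /t; apply: (big_ind2 (fun x y => complex.Im x = y)) => //= -[a b] x [a' b'] y <- <-.
rewrite -t1 in h1; rewrite -t2 in h2.
have -> : s1 +i* s2 - t = (s1 - complex.Re t)%:C + 'i%C * (s2 - complex.Im t)%:C.
  by case: t {t1 t2 h1 h2} => a b /=; simpc.
apply: le_lt_trans (ler_normD _ _) _.
rewrite normrM normi mul1r.
have nr (x : R) : `|x%:C| = `|x|%:C by rewrite normc_def /= expr0n /= addr0 sqrtr_sqr.
rewrite !nr -rmorphD /= -re ltcR; lra.
Qed.

Lemma eq_usum I (f g : I -> K) : f =1 g -> usum f = usum g.
Proof. by move=> /funext ->. Qed.

Lemma eq_asum I (f g : I -> K) : f =1 g -> asum f -> asum g.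
Proof. by move=> /funext ->. Qed.

Lemma hsumD I (f g : I -> K) s t : hsum f s -> hsum g t ->
  hsum (fun x => f x + g x) (s + t).
Proof.
move=> H1 H2 e e0; have e2 : 0 < e / 2 by rewrite divr_gt0.
have [A1 HA1] := H1 _ e2; have [A2 HA2] := H2 _ e2.
exists (A1 `|` A2)%fset => B; rewrite fsubUset => /andP[B1 B2].
have := ltrD (HA1 _ B1) (HA2 _ B2); rewrite -splitr; apply: le_lt_trans.
by rewrite big_split /= opprD addrACA ler_normD.
Qed.

Lemma hsumZ I (f : I -> K) a s : hsum f s -> hsum (fun x => a * f x) (a * s).
Proof.
move=> H e e0; have [->|a0] := eqVneq a 0.
  exists fset0 => B _; rewrite mul0r big1 ?subrr ?normr0 // => x _.
  by rewrite mul0r.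
have na : 0 < `|a| by rewrite normr_gt0.
have [A HA] := H _ (divr_gt0 e0 na).
exists A => B AB; rewrite -mulr_sumr -mulrBr normrM -ltr_pdivlMl // mulrC.
exact: HA.
Qed.

Lemma usumD I (f g : I -> K) : asum f -> asum g ->
  usum (fun x => f x + g x) = usum f + usum g.
Proof. by move=> /asum_hsum H1 /asum_hsum H2; apply/hsum_usum/hsumD. Qed.

Lemma usumZ I (f : I -> K) a : asum f -> usum (fun x => a * f x) = a * usum f.
Proof. by move=> /asum_hsum H1; apply/hsum_usum/hsumZ. Qed.

Lemma asumZ I (f : I -> K) a : asum f -> asum (fun x => a * f x).
Proof.
move=> [c H]; exists (`|a| * c) => A.
under eq_bigr do rewrite normrM.
by rewrite -mulr_sumr ler_wpM2l.
Qed.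

Lemma asum_le I (f g : I -> K) c : 0 <= c ->
  (forall x, `|f x| <= c * `|g x|) -> asum g -> asum f.
Proof.
move=> c0 fg [d H]; exists (c * d) => A.
by apply: le_trans (ler_wpM2l c0 (H A)); rewrite mulr_sumr ler_sum.
Qed.

Lemma asumD I (f g : I -> K) : asum f -> asum g -> asum (fun x => f x + g x).
Proof.
move=> [c1 H1] [c2 H2]; exists (c1 + c2) => A.
apply: le_trans (lerD (H1 A) (H2 A)).
by rewrite -big_split ler_sum //= => x _; exact: ler_normD.
Qed.

Lemma hsum_fset I (f : I -> K) (A : {fset I}) :
  (forall x, x \notin A -> f x = 0) -> hsum f (\sum_(x <- A) f x).
Proof.
move=> f0 e e0; exists A => B AB.
rewrite (_ : \sum_(x <- B) f x = \sum_(x <- A) f x) ?subrr ?normr0 //.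
by apply/esym/big_fset_incl => // x _; exact: f0.
Qed.

Lemma usum1 I (f : I -> K) (x : I) : (forall y, y != x -> f y = 0) ->
  usum f = f x.
Proof.
move=> f0; apply: hsum_usum; rewrite -(big_seq_fset1 +%R x f).
by apply: hsum_fset => y; rewrite inE => /f0.
Qed.

Lemma usum0 I (f : I -> K) : (forall y, f y = 0) -> usum f = 0.
Proof.
move=> f0; apply: hsum_usum; rewrite -(big_seq_fset0 +%R f).
exact: hsum_fset.
Qed.

(** It is enough that [h] reaches the support of [f]: finite sets are pulled back through a partial
    inverse of [h], obtained by choice. *)
Lemma hsum_reindex I J (h : J -> I) (f : I -> K) s : injective h ->
  (forall x, f x != 0 -> exists y, x = h y) ->
  hsum f s -> hsum (f \o h) s.
Proof.
move=> hinj hsupp H e e0; have [A HA] := H _ e0.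
pose g x := if pselect (exists y, x = h y) is left E then Some (xchoose
  (P := fun y => x == h y) (let: ex_intro y E := E in ex_intro _ y (introT eqP E))) else None.
have gh y : g (h y) = Some y.
  rewrite /g; case: pselect => [E|[]]; last by exists y.
  by congr Some; apply: hinj; apply/esym/eqP; exact: (xchooseP (P := fun z => h y == h z)).
have hg x y : g x = Some y -> x = h y.
  rewrite /g; case: pselect => // E [<-]; apply/eqP.
  exact: (xchooseP (P := fun z => x == h z)).
exists [fset y in pmap g A]%fset => B AB.
have -> : \sum_(x <- B) (f \o h) x = \sum_(x <- [fset h y | y in B]%fset) f x.
  rewrite big_imfset //= => y z _ _; exact: hinj.
set B' := [fset h y | y in B]%fset.
(* Points of [A] outside the image of [B] carry zero terms: otherwise their preimage would lie in
   [B]. *)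
have := HA (A `|` B')%fset (fsubsetUl _ _).
rewrite (_ : \sum_(x <- (A `|` B')%fset) f x = \sum_(x <- B') f x) //.
apply/esym/big_fset_incl; first exact: fsubsetUr.
move=> x; rewrite inE => /orP[xA|->//] xB.
apply/eqP/negPn/negP => fx.
have [y xy] := hsupp _ fx.
case/negP: xB; rewrite xy in_imfset //=; apply: (fsubsetP AB).
rewrite !inE mem_pmap; apply/mapP; exists x => //; by rewrite xy gh.
Qed.

Lemma asum_comp I J (h : J -> I) (f : I -> K) : injective h ->
  asum f -> asum (f \o h).
Proof.
move=> hinj [c H]; exists c => A; apply: le_trans (H [fset h y | y in A]%fset).
by rewrite big_imfset //= => y z _ _; exact: hinj.
Qed.

Lemma usum_reindex I J (h : J -> I) (f : I -> K) : injective h ->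
  (forall x, f x != 0 -> exists y, x = h y) -> asum f ->
  usum f = usum (fun y => f (h y)).
Proof.
by move=> hi hs /asum_hsum H; apply/esym/hsum_usum/(hsum_reindex hi hs).
Qed.

Lemma asum_bij I J (h : J -> I) (h' : I -> J) (f : I -> K) : cancel h' h ->
  asum (fun y => f (h y)) -> asum f.
Proof.
move=> hK /(asum_comp (can_inj hK)) [c H]; exists c => A.
by apply: le_trans (H A); apply: ler_sum => x _ /=; rewrite hK.
Qed.

Lemma usum_bij I J (h : J -> I) (h' : I -> J) (f : I -> K) :
  cancel h h' -> cancel h' h -> asum (fun y => f (h y)) ->
  usum f = usum (fun y => f (h y)).
Proof.
move=> hK h'K fs; apply: usum_reindex; first exact: can_inj hK.
  by move=> x _; exists (h' x).
exact: asum_bij fs.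
Qed.

Lemma asum_row I J (f : I * J -> K) i : asum f -> asum (fun j => f (i, j)).
Proof. by apply: (@asum_comp _ _ (fun j => (i, j))) => x y []. Qed.

Lemma asum_col I J (f : I * J -> K) j : asum f -> asum (fun i => f (i, j)).
Proof. by apply: (@asum_comp _ _ (fun i => (i, j))) => x y []. Qed.

Lemma sum_fset_prod I J (f : I * J -> K) (A : {fset I}) (B : {fset J}) :
  \sum_(x <- (A `*` B)%fset) f x = \sum_(i <- A) \sum_(j <- B) f (i, j).
Proof.
rewrite /fsetM big_imfset2 //=.
by move=> [i j] [i' j'] _ _ /= [-> ->].
Qed.

Lemma ler_usum I (f : I -> K) (c : K) : asum f ->
  (forall A : {fset I}, \sum_(x <- A) `|f x| <= c) -> `|usum f| <= c.
Proof.
move=> /asum_hsum H fc.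
have c0 : c \is Num.real by apply: (@ger0_real K); have := fc fset0; rewrite big_seq_fset0.
rewrite real_leNgt // ?ger0_real //; apply/negP; rewrite -subr_gt0 => e0.
have [A HA] := H _ e0.
have := le_lt_trans (lerB_dist _ _) (HA A (fsubset_refl _)).
rewrite ltrD2l ltrN2 => /lt_le_trans /(_ (ler_norm_sum _ _ _)) h.
by have := lt_le_trans h (fc A); rewrite ltxx.
Qed.

(** One finite set of columns must serve all rows of [B], so it is chosen after [B], each row being
    allowed the error e/2/n. The successor in n = |B| + 1 keeps the divisor positive when [B] is
    empty. *)
Lemma hsum_fubini I J (f : I * J -> K) s (g : I -> K) : hsum f s ->
  (forall i, hsum (fun j => f (i, j)) (g i)) -> hsum g s.
Proof.
move=> H Hg e e0; have e2 : 0 < e / 2 by rewrite divr_gt0.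
have [A HA] := H _ e2.
exists [fset x.1 | x in A]%fset => B AB.
pose n := (size B)%:R + 1 : K.
have n0 : 0 < n by rewrite ltr_wpDl ?ler0n.
have hB i := Hg i _ (divr_gt0 e2 n0).
pose F i := projT1 (cid (hB i)).
have HF i : forall C, (F i `<=` C)%fset ->
    `|g i - \sum_(j <- C) f (i, j)| < e / 2 / n := projT2 (cid (hB i)).
pose C := ([fset x.2 | x in A] `|` \bigcup_(i <- B) F i)%fset.
have sub : (A `<=` B `*` C)%fset.
  apply/fsubsetP => -[i j] ijA; rewrite !inE /=; apply/andP; split.
    by apply: (fsubsetP AB); apply/imfsetP; exists (i, j).
  by apply/orP; left; apply/imfsetP; exists (i, j).
have := HA _ sub; rewrite sum_fset_prod => h1.
have h2 : `|\sum_(i <- B) g i - \sum_(i <- B) \sum_(j <- C) f (i, j)| <= e / 2.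
  rewrite -sumrB; apply: le_trans (ler_norm_sum _ _ _) _.
  have : \sum_(i <- B) `|g i - \sum_(j <- C) f (i, j)| <= \sum_(i <- B) (e / 2 / n).
    rewrite !big_seq; apply: ler_sum => i iB; apply/ltW/HF.
    apply/fsubsetP => j jF; rewrite inE; apply/orP; right.
    by apply/bigfcupP; exists i => //; rewrite iB.
  move=> /le_trans; apply.
  rewrite big_const_seq count_predT iter_addr addr0 -[leLHS]mulr_natr -mulrA ler_piMr ?ltW //.
  by rewrite mulrC ltr_pdivrMr // mul1r /n ltrDl.
rewrite (_ : s - _ = (s - \sum_(i <- B) \sum_(j <- C) f (i, j)) -
  (\sum_(i <- B) g i - \sum_(i <- B) \sum_(j <- C) f (i, j))); last by ring.
apply: le_lt_trans (ler_normB _ _) _.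
by rewrite [ltRHS](splitr e) ltr_leD.
Qed.

Lemma usum_fubini I J (f : I * J -> K) : asum f ->
  usum f = usum (fun i => usum (fun j => f (i, j))).
Proof.
move=> fs; apply/esym/hsum_usum.
by apply: (hsum_fubini (asum_hsum fs)) => i; exact/asum_hsum/asum_row.
Qed.

Lemma asum_swap I J (f : I * J -> K) : asum f -> asum (fun x => f (x.2, x.1)).
Proof. by apply: (@asum_comp _ _ (fun x => (x.2, x.1))) => -[? ?] [? ?] [-> ->]. Qed.

Lemma usum_swap I J (f : I * J -> K) : asum f ->
  usum f = usum (fun j => usum (fun i => f (i, j))).
Proof.
move=> fs; rewrite (@usum_bij _ _ (fun x => (x.2, x.1)) (fun x => (x.2, x.1))).
- exact/usum_fubini/asum_swap.
- by case.
- by case.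
- exact: asum_swap.
Qed.

Lemma asum_prod I J (f : I -> K) (g : J -> K) : asum f -> asum g ->
  asum (fun x => f x.1 * g x.2).
Proof.
move=> [c Hc] [d Hd]; exists (c * d) => A.
pose B := ([fset x.1 | x in A] `*` [fset x.2 | x in A])%fset.
have sub : (A `<=` B)%fset.
  apply/fsubsetP => x xA; rewrite inE; apply/andP; split.
    by apply/imfsetP; exists x.
  by apply/imfsetP; exists x.
apply: (@le_trans _ _ (\sum_(x <- B) `|f x.1 * g x.2|)).
  exact: fset_sum_le sub.
rewrite /B (sum_fset_prod (fun x => `|f x.1 * g x.2|)) /=.
under eq_bigr do under eq_bigr do rewrite normrM.
under eq_bigr do rewrite -mulr_sumr.
by rewrite -mulr_suml ler_pM // sumr_ge0.
Qed.

Lemma usumM I J (f : I -> K) (g : J -> K) : asum f -> asum g ->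
  usum f * usum g = usum (fun x => f x.1 * g x.2).
Proof.
move=> fs gs; rewrite (usum_fubini (asum_prod fs gs)) /=.
under [RHS]eq_usum do rewrite usumZ //.
under [RHS]eq_usum do rewrite mulrC.
by rewrite usumZ // mulrC.
Qed.

(** The row sums over [B] are replaced by finite sums over a common set of columns, with total error
    at most 1; hence the bound c + 1. *)
Lemma asum_usum I J (f : I * J -> K) : asum f ->
  asum (fun i => usum (fun j => f (i, j))).
Proof.
move=> fs; have [c H] := fs; exists (c + 1) => B.
pose n := (size B)%:R + 1 : K.
have n0 : 0 < n by rewrite ltr_wpDl ?ler0n.
have hB i := asum_hsum (asum_row i fs) (divr_gt0 ltr01 n0).
pose F i := projT1 (cid (hB i)).
have HF i : forall C, (F i `<=` C)%fset ->
    `|usum (fun j => f (i, j)) - \sum_(j <- C) f (i, j)| < 1 / n := projT2 (cid (hB i)).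
pose C := (\bigcup_(i <- B) F i)%fset.
apply: (@le_trans _ _ (\sum_(i <- B) (`|\sum_(j <- C) f (i, j)| + 1 / n))).
  rewrite !big_seq; apply: ler_sum => i iB.
  have /ltW : `|usum (fun j => f (i, j)) - \sum_(j <- C) f (i, j)| < 1 / n.
    apply: HF; apply/fsubsetP => j jF.
    by apply/bigfcupP; exists i => //; rewrite iB.
  by rewrite -lerBlDl; apply: le_trans; exact: lerB_dist.
rewrite big_split /= lerD //.
  apply: le_trans (H (B `*` C)%fset).
  rewrite (sum_fset_prod (fun x => `|f x|)); apply: ler_sum => i _.
  exact: ler_norm_sum.
rewrite big_const_seq count_predT iter_addr addr0 -[leLHS]mulr_natr mul1r.
by rewrite mulrC ler_pdivrMr // mul1r /n lerDl.
Qed.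

End UnconditionalSums.

(** * Linear lower bounds for quadratic exponents, and residues of integers *)

Lemma sqr_ge_linear (m : nat) (t : int) : m%:Z * `|t|%N%:Z - m%:Z * m%:Z <= t * t.
Proof.
have -> : t * t = `|t|%N%:Z * `|t|%N%:Z by nia.
by move: `|t|%N => x; have := sqr_ge0 (x%:Z - m%:Z); rewrite expr2; nia.
Qed.

Lemma mul_ge_linear (x y : int) (s : nat) : (`|y| <= s)%N ->
  - (`|x|%N%:Z * s%:Z) <= x * y.
Proof.
move=> ys; have : `|x|%N%:Z * `|y|%N%:Z <= `|x|%N%:Z * s%:Z by rewrite ler_wpM2l.
by have : x * y >= - (`|x|%N%:Z * `|y|%N%:Z); [nia | lia].
Qed.

Lemma absz_le_sqr (t : int) : `|t|%N%:Z <= t * t.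
Proof. by nia. Qed.

Lemma sqrB_ge_absz (s : nat) (t : int) :
  `|t|%N%:Z - ((s + 2) ^ 2)%N%:Z <= t * (t - 1) - s%:Z * `|t|%N%:Z.
Proof.
have H := sqr_ge_linear (s + 2)%N t; have tt : t <= `|t|%N%:Z by clear; lia.
by rewrite -mulnn; move: `|t|%N H tt => x; lia.
Qed.

Lemma int_parity (t : int) : exists m, t = 2 * m \/ t = 2 * m + 1.
Proof. by exists (t %/ 2)%Z; lia. Qed.

Lemma int_mod3 (s : int) : exists n, [\/ s = 3 * n, s = 3 * n + 1 | s = 3 * n + 2].
Proof.
exists (s %/ 3)%Z.
have [E|[E|E]] : s = 3 * (s %/ 3)%Z \/ (s = 3 * (s %/ 3)%Z + 1 \/ s = 3 * (s %/ 3)%Z + 2).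
- by lia.
- by constructor 1.
- by constructor 2.
- by constructor 3.
Qed.

(** * Geometric majorants and bounds for q-Pochhammer symbols *)

Section Bounds.
Context {R : realType}.
Local Notation K := R[i].
Implicit Types (I J : choiceType).

Lemma expr_small (x e : K) : 0 <= x -> x < 1 -> 0 < e ->
  exists N : nat, x ^+ N < e.
Proof.
move=> x0 x1 e0.
have rx : (complex.Re x)%:C = x by exact/RRe_real/ger0_real.
have re : (complex.Re e)%:C = e by exact/RRe_real/gtr0_real.
rewrite -re -rx in x0 x1 e0 *; move: (complex.Re x) (complex.Re e) x0 x1 e0 => {rx re}x {}e.
rewrite lecR !ltcR => x0 x1 e0.
have /cvgrPdist_lt /(_ _ e0) [N _ HN] : ((fun n => x ^+ n) @ \oo --> 0)%classic.
  by apply: cvg_expr; rewrite ger0_norm.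
exists N; rewrite -rmorphXn ltcR; have := HN N (leqnn N).
by rewrite sub0r normrN ger0_norm // exprn_ge0.
Qed.

Lemma geometric_fset_sum (x : K) (A : {fset nat}) : 0 <= x -> x < 1 ->
  \sum_(n <- A) x ^+ n <= (1 - x)^-1.
Proof.
move=> x0 x1; have y0 : 0 < 1 - x by rewrite subr_gt0.
pose N := (\max_(n <- A) n).+1.
apply: (@le_trans _ _ (\sum_(n <- [fset i in iota 0 N]%fset) x ^+ n)).
  apply: fset_sum_le => [n|]; first exact: exprn_ge0.
  apply/fsubsetP => n nA; have := @leq_bigmax_seq _ (enum_fset A) xpredT (fun n => n) n nA isT.
  by rewrite !inE /= mem_iota ltnS; case: n {nA} => //= n ->.
have -> M : \sum_(n <- [fset i in iota 0 M]%fset) x ^+ n = \sum_(n < M) x ^+ n.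
  rewrite big_imfset //= undup_id ?iota_uniq //.
  by rewrite -(big_mkord xpredT (fun n => x ^+ n)) /index_iota subn0.
rewrite -[leRHS]mul1r ler_pdivlMr // mulrC.
have := subrX1 x N; rewrite -[X in _ = X]opprK -mulNr opprB => H.
have -> : (1 - x) * \sum_(i < N) x ^+ i = 1 - x ^+ N by rewrite -[LHS]opprK -H opprB.
by rewrite lerBlDr lerDl exprn_ge0.
Qed.

Lemma asum_int (f : int -> K) : asum (fun n : nat => f n%:Z) ->
  asum (fun n : nat => f (Negz n)) -> asum f.
Proof.
move=> [c Hc] [d Hd]; exists (c + d) => A.
pose P := [fset `|a|%N | a in A]%fset.
pose Q := [fset (`|a|.-1)%N | a in A]%fset.
pose B := ([fset Posz n | n in P] `|` [fset Negz n | n in Q])%fset.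
have sub : (A `<=` B)%fset.
  apply/fsubsetP => -[n|n] nA; rewrite inE; apply/orP; [left|right].
    by apply/imfsetP; exists n => //; apply/imfsetP; exists (Posz n).
  by apply/imfsetP; exists n => //; apply/imfsetP; exists (Negz n).
apply: le_trans (fset_sum_le _ sub) _ => //.
rewrite /B (big_fsetID _ (fun a : int => 0 <= a)) /=.
apply: lerD.
  have E : \sum_(a <- [fset Posz n | n in P]%fset) `|f a| = \sum_(n <- P) `|f n%:Z|.
    by rewrite big_imfset //= => a b _ _ [].
  apply: le_trans (Hc P); rewrite -E.
  apply: fset_sum_le => //; apply/fsubsetP => a; rewrite !inE => /andP[/orP[//|]].
  by move=> /imfsetP[n _ ->].
have E : \sum_(a <- [fset Negz n | n in Q]%fset) `|f a| = \sum_(n <- Q) `|f (Negz n)|.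
    by rewrite big_imfset //= => a b _ _ [].
  apply: le_trans (Hd Q); rewrite -E.
apply: fset_sum_le => //; apply/fsubsetP => a; rewrite !inE => /andP[/orP[|//]].
by move=> /imfsetP[n _ ->].
Qed.

Lemma asum_geom (x : K) : 0 <= x -> x < 1 -> asum (fun a : int => x ^+ `|a|).
Proof.
move=> x0 x1; apply: asum_int.
  exists (1 - x)^-1 => A; apply: le_trans (geometric_fset_sum A x0 x1).
  by apply: ler_sum => n _; rewrite ger0_norm ?exprn_ge0.
exists (1 - x)^-1 => A; apply: le_trans (geometric_fset_sum A x0 x1).
apply: ler_sum => n _; rewrite ger0_norm ?exprn_ge0 //= exprS.
by rewrite ler_piMl ?exprn_ge0 // ltW.
Qed.

Lemma asum_geom2 (x : K) : 0 <= x -> x < 1 ->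
  asum (fun a : int * int => x ^+ (`|a.1| + `|a.2|)).
Proof.
move=> x0 x1; apply: eq_asum (asum_prod (asum_geom x0 x1) (asum_geom x0 x1)) => a /=.
by rewrite exprD.
Qed.

Lemma asum_geom3 (x : K) : 0 <= x -> x < 1 ->
  asum (fun a : int * int * int => x ^+ (`|a.1.1| + `|a.1.2| + `|a.2|)).
Proof.
move=> x0 x1; apply: eq_asum (asum_prod (asum_geom2 x0 x1) (asum_geom x0 x1)) => a /=.
by rewrite !exprD.
Qed.

Lemma asum_geom4 (x : K) : 0 <= x -> x < 1 ->
  asum (fun a : int * int * int * int =>
    x ^+ (`|a.1.1.1| + `|a.1.1.2| + `|a.1.2| + `|a.2|)).
Proof.
move=> x0 x1; apply: eq_asum (asum_prod (asum_geom3 x0 x1) (asum_geom x0 x1)) => a /=.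
by rewrite !exprD.
Qed.

Lemma normrXz (x : K) (n : int) : `|x ^ n| = `|x| ^ n.
Proof. by case: n => n; rewrite /exprz ?normfV normrX. Qed.

(** The common way to use the lower bounds on exponents: a linear bound n - c becomes a geometric
    majorant, with c absorbing possibly negative exponents. *)
Lemma exprz_bound (q : K) (c n : nat) (e : int) : 0 < `|q| -> `|q| < 1 ->
  n%:Z - c%:Z <= e -> `|q ^ e| <= `|q| ^- c * `|q| ^+ n.
Proof.
move=> q0 q1 ne.
have -> : `|q| ^- c * `|q| ^+ n = `|q| ^ (n%:Z - c%:Z).
  by rewrite expfzDr ?gt_eqF // mulrC -exprz_inv -exprVn.
rewrite normrXz -(subrK (n%:Z - c%:Z) e) expfzDr ?gt_eqF //.
have : 0 <= e - (n%:Z - c%:Z) by rewrite subr_ge0.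
case: (e - _) => // m _; apply: ler_piMl; first exact/exprz_ge0/ltW.
by rewrite -exprnP exprn_ile1 // ltW.
Qed.

(* Extended by 0 to negative [a], so that all sums run over the integers and
   [rp_pred] holds without restriction. *)
Definition rqpoch (p : K) (a : int) : K :=
  if a is Posz n then (qpoch p p n)^-1 else 0.

Lemma rp0 p : rqpoch p 0 = 1.
Proof. by rewrite /= /qpoch big_ord0 invr1. Qed.

Lemma rp_neg p a : a < 0 -> rqpoch p a = 0.
Proof. by case: a. Qed.

Lemma qpochS (a p : K) n : qpoch a p n.+1 = qpoch a p n * (1 - a * p ^+ n).
Proof. by rewrite /qpoch big_ord_recr. Qed.

Lemma normr_lt1_subr_neq0 (x : K) : `|x| < 1 -> 1 - x != 0.
Proof.
move=> x1; apply/eqP => /eqP; rewrite subr_eq0 => /eqP e.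
by move: x1; rewrite -e normr1 ltxx.
Qed.

Lemma qpoch_neq0 (p : K) n : `|p| < 1 -> qpoch p p n != 0.
Proof.
move=> p1; apply/prodf_neq0 => k _; apply: normr_lt1_subr_neq0.
by rewrite -exprS normrX exprn_ilt1 // normr_ge0.
Qed.

Lemma rp_pred (p : K) a : 0 < `|p| -> `|p| < 1 ->
  rqpoch p (a - 1) = (1 - p ^ a) * rqpoch p a.
Proof.
move=> p0 p1; case: a => [[|n]|n].
- by rewrite expr0z subrr mul0r.
- rewrite (_ : n.+1%:Z - 1 = n) /=; last lia.
  rewrite qpochS -exprS invfM mulrC -mulrA mulVf ?mulr1 //.
  by apply: normr_lt1_subr_neq0; rewrite normrX exprn_ilt1 // normr_ge0.
- by rewrite mulr0 rp_neg //; lia.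
Qed.

(** The products (p)_n stay away from 0. Past an index N with |p|^N < (1 - |p|)/2 the remaining
    factors cannot shrink the modulus below half of |(p)_N|; the finitely many earlier reciprocals
    are simply added to the bound. *)
Lemma rp_bound (p : K) : `|p| < 1 -> exists d : K, 0 <= d /\ forall a, `|rqpoch p a| <= d.
Proof.
move=> p1; set x := `|p| in p1 *; have x0 : 0 <= x by exact: normr_ge0.
have y0 : 0 < 1 - x by rewrite subr_gt0.
have [N HN] := expr_small x0 p1 (divr_gt0 y0 (ltr0n _ 2)).
have HN1 : x ^+ N.+1 <= (1 - x) / 2.
  by apply: le_trans (ltW HN); rewrite exprS ler_piMl ?exprn_ge0 // ltW.
(* The factor (1 + x^m)/2, which decreases to 1/2, makes the induction close: one step costs at most
   1 - x^(N+m+1), while (1 + x^m)/2 drops by x^m (1 - x)/2. *)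
have H m : `|qpoch p p N| * ((1 + x ^+ m) / 2) <= `|qpoch p p (N + m)|.
  elim: m => [|m IH].
    by rewrite addn0 expr0 (_ : 1 + 1 = 2) // divff ?pnatr_eq0 ?mulr1.
  rewrite addnS qpochS normrM -exprS.
  have h : 1 - x ^+ (N + m).+1 <= `|1 - p ^+ (N + m).+1|.
    by have := lerB_dist 1 (p ^+ (N + m).+1); rewrite normr1 normrX.
  have h0 : 0 <= 1 - x ^+ (N + m).+1 by rewrite subr_ge0 exprn_ile1 // ltW.
  apply: le_trans (ler_pM _ h0 IH h); last by rewrite !mulr_ge0 ?addr_ge0 ?exprn_ge0 ?invr_ge0.
  rewrite -[leRHS]mulrA ler_wpM2l // mulrAC ler_wpM2r ?invr_ge0 //.
  rewrite -addSn exprD exprS.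
  set u := x ^+ m; set v := x ^+ N.+1 in HN1 *.
  have u0 : 0 <= u by rewrite exprn_ge0.
  have u1 : u <= 1 by rewrite exprn_ile1 // ltW.
  rewrite -subr_ge0 (_ : _ - _ = u * ((1 - x) - v - v * u)); last by ring.
  rewrite mulr_ge0 // -addrA -opprD subr_ge0.
  rewrite [leRHS](splitr (1 - x)) lerD // (le_trans _ HN1) // ler_piMr //.
  by rewrite exprn_ge0.
exists (\sum_(k < N) `|rqpoch p k| + 2 * `|rqpoch p N|); split.
  by rewrite addr_ge0 ?sumr_ge0 ?mulr_ge0.
move=> [n|n]; last by rewrite normr0 addr_ge0 ?sumr_ge0 ?mulr_ge0.
have [nN|Nn] := ltnP n N.
  rewrite (bigD1 (Ordinal nN)) //= -addrA lerDl addr_ge0 ?sumr_ge0 ?mulr_ge0 //.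
apply: (@le_trans _ _ (2 * `|rqpoch p N|)); last by rewrite lerDr sumr_ge0.
rewrite /= !normfV.
have q0 k : 0 < `|qpoch p p k| by rewrite normr_gt0 qpoch_neq0.
rewrite -[leLHS]mul1r ler_pdivrMr // mulrAC ler_pdivlMr // mul1r.
have := H (n - N)%N; rewrite subnKC // => /(ler_wpM2l (ler0n _ 2)); apply: le_trans.
by rewrite mulrCA [2 * (_ / 2)]mulrC divfK ?pnatr_eq0 // ler_peMr // lerDl exprn_ge0.
Qed.

End Bounds.

Lemma int_shift_cst (T : Type) (f : int -> T) : (forall n, f (n + 1) = f n) ->
  forall n, f n = f 0.
Proof.
move=> fS; have Sn (k : nat) l : f (l + k%:Z) = f l.
  elim: k => [|k IH]; first by rewrite addr0.
  by rewrite -[RHS]IH -[RHS]fS; congr f; lia.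
move=> m; case: (ger0P m) => k0; first by rewrite -(Sn `|m|%N 0) add0r gez0_abs.
by rewrite -(Sn `|m|%N m) ltz0_abs // subrr.
Qed.

(** * Durfee's identity *)

Section Durfee.
Context {R : realType}.
Local Notation K := R[i].
Implicit Types (I J : choiceType).

(** The summability criterion for all theta-like families below. The exponent is controlled only
    where [f] is nonzero, so that the vanishing of [rqpoch] at negative indices can be exploited. *)
Lemma asum_exp I (w : I -> nat) (q d : K) (c : nat) (e : I -> int) (f : I -> K) :
  0 < `|q| -> `|q| < 1 -> asum (fun x => `|q| ^+ w x) ->
  (forall x, f x != 0 -> (w x)%:Z - c%:Z <= e x) ->
  (forall x, `|f x| <= d) -> asum (fun x => q ^ e x * f x).
Proof.
move=> q0 q1 ws we fd; have ge0 := normr_ge0 q.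
have c0 : 0 <= `|q| ^- c by rewrite invr_ge0 exprn_ge0.
(* If [d] is not >= 0 then [I] is empty, because 0 <= |f x| <= d for every x. *)
have [|d0] := boolP (0 <= d); last first.
  exists 0 => A; rewrite big1 // => x _; case/negP: d0.
  exact: le_trans (normr_ge0 _) (fd x).
move=> d0; apply: (@asum_le _ _ _ (fun x => `|q| ^+ w x) (`|q| ^- c * d)) => //.
  exact: mulr_ge0.
move=> x; rewrite normrM (ger0_norm (exprn_ge0 _ ge0)) mulrAC.
have [->|fx] := eqVneq (f x) 0.
  by rewrite normr0 mulr0 !mulr_ge0 // exprn_ge0.
by apply: ler_pM => //; exact: exprz_bound (we _ fx).
Qed.

Variables (p : K) (p0 : 0 < `|p|) (p1 : `|p| < 1).
Local Notation rp := (rqpoch p).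

Let pn0 : p != 0. Proof. by rewrite -normr_gt0. Qed.

Lemma asum_durfee (m k : int) :
  asum (fun b : int => p ^ (b * (b + m) - b * k) * (rp b * rp (b + m))).
Proof.
have [d [d0 Hd]] := rp_bound p1.
apply: (@asum_exp _ (fun b => `|b|%N) _ (d * d) ((`|m - k|.+1) ^ 2)%N) => //.
- by apply: asum_geom => //; exact: ltW.
- move=> b _; rewrite (_ : b * (b + m) - b * k = b * b + b * (m - k)); last by ring.
  move: (m - k) => s.
  have : b * s >= - (`|b|%N%:Z * `|s|%N%:Z) by nia.
  have : b * b = `|b|%N%:Z * `|b|%N%:Z by nia.
  move: `|b|%N `|s|%N => x y -> h.
  have : x%:Z - ((y.+1) ^ 2)%N%:Z <= x%:Z * x%:Z - x%:Z * y%:Z by nia.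
  by lia.
- by move=> b; rewrite normrM ler_pM.
Qed.

(** The Durfee rectangle sum, equal to 1/(p)_oo for every integer m. Independence of m and the value
    are shown separately, in [durfee_const] and [durfee0_qpoch_inf]. *)
Definition durfee (m : int) : K := usum (fun b : int => p ^ (b * (b + m)) * (rp b * rp (b + m))).

Lemma asum_durfee0 (m : int) : asum (fun b : int => p ^ (b * (b + m)) * (rp b * rp (b + m))).
Proof. by apply: eq_asum (asum_durfee m 0) => b; rewrite mulr0 subr0. Qed.

(** The factor in rp(b + m) = (1 - p^(b+m+1)) rp(b + m + 1) is split as p^b + (1 - p^b) - p^(m+1)
    p^b. The outer parts give [durfee (m + 1)]; the middle one lowers the index of [rp b] and, after
    a shift of b, gives [durfee (m + 2)]. *)
Lemma durfee_rec (m : int) :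
  durfee m - durfee (m + 1) = p ^ (m + 1) * (durfee (m + 2) - durfee (m + 1)).
Proof.
pose A b := p ^ (b * (b + (m + 1))) * (rp b * rp (b + (m + 1))).
pose B b := p ^ (b * (b + m)) * (rp (b - 1) * rp (b + (m + 1))).
have As : asum A by exact: asum_durfee0.
have Bs : asum (fun b => B (b + 1)).
  apply: eq_asum (asumZ (p ^ (m + 1)) (asum_durfee0 (m + 2))) => b.
  rewrite /B /= addrK mulrA -expfzDr //; congr (_ ^ _ * (_ * rp _)); ring.
have BK : cancel (fun b : int => b - 1) (fun b => b + 1) by move=> b; rewrite subrK.
have KB : cancel (fun b : int => b + 1) (fun b => b - 1) by move=> b; rewrite addrK.
have EB : usum B = p ^ (m + 1) * durfee (m + 2).
  rewrite (usum_bij KB BK Bs) -usumZ; last exact: asum_durfee0.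
  apply: eq_usum => b.
  rewrite /B addrK [RHS]mulrA -expfzDr //; congr (_ ^ _ * (_ * rp _)); ring.
have {}Bs : asum B by exact: asum_bij BK Bs.
have E : durfee m = usum (fun b => A b + (B b + (- p ^ (m + 1)) * A b)).
  apply: eq_usum => b.
  have -> : rp (b + m) = (1 - p ^ (b + (m + 1))) * rp (b + (m + 1)).
    by rewrite -rp_pred //; congr rp; ring.
  rewrite /A /B rp_pred // !mulrDr !mulr1 !expfzDr // expr1z; ring.
rewrite E usumD //; last by apply: asumD => //; exact: asumZ.
rewrite usumD //; last exact: asumZ.
rewrite usumZ // EB /durfee -/(durfee (m + 2)); ring.
Qed.

(* The term b = 0 dominates; together with [durfee_rec], which makes the
   differences of consecutive values tend to 0 too fast, this forces
   [durfee] to be constant. *)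
Lemma durfee_near :
  exists c : K, 0 <= c /\ forall m : nat, `|durfee m%:Z - rp m| <= c * `|p| ^+ m.
Proof.
have [d [d0 Hd]] := rp_bound p1.
have [c Hc] := asum_geom (ltW p0) p1.
have c0 : 0 <= c by have := Hc fset0; rewrite big_seq_fset0.
exists (d * d * c); split; first by rewrite !mulr_ge0.
move=> m.
pose g (b : int) : K := p ^ (b * (b + m%:Z)) * (rp b * rp (b + m%:Z)) + - ((b == 0)%:R * rp m).
have ds : asum (fun b : int => (b == 0)%:R * rp m).
  exists (\sum_(b <- [fset 0 : int]%fset) `|(b == 0)%:R * rp m|) => A.
  apply: (@le_trans _ _ (\sum_(b <- (0 |` A)%fset) `|(b == 0)%:R * rp m|)).
    by apply: fset_sum_le => //; exact: fsubsetU1.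
  rewrite (big_fsetD1 (0 : int)) ?fset1U1 //= big_seq_fset1 gerDl big1_fset //.
  by move=> b; rewrite !inE => /andP[/negPf -> _] _; rewrite mul0r normr0.
have dsN : asum (fun b : int => - ((b == 0)%:R * rp m)).
  by apply: eq_asum (asumZ (-1) ds) => b; rewrite mulN1r.
have gs : asum g by exact: (asumD (asum_durfee0 m) dsN).
have -> : durfee m%:Z - rp m = usum g.
  rewrite /g (usumD (asum_durfee0 m) dsN); congr (_ + _).
  rewrite (usum1 (x := 0)) ?eqxx ?mul1r // => b /negPf ->.
  by rewrite mul0r oppr0.
apply: ler_usum => // A.
apply: (@le_trans _ _ (d * d * `|p| ^+ m * \sum_(b <- A) (`|(`|p| ^+ `|b|)|))); last first.
  by rewrite mulrAC ler_wpM2r ?exprn_ge0 // ler_wpM2l ?mulr_ge0.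
rewrite mulr_sumr; apply: ler_sum => b _.
rewrite /g (ger0_norm (exprn_ge0 _ (normr_ge0 p))).
have [->|b0] := eqVneq b 0.
  by rewrite mul0r expr0z rp0 !mul1r add0r subrr normr0 !mulr_ge0 // exprn_ge0.
rewrite mul0r subr0.
have [b_lt0|b_ge0] := ltP b 0.
  by rewrite rp_neg // mul0r mulr0 normr0 !mulr_ge0 // exprn_ge0.
rewrite !normrM mulrC -mulrA; apply: ler_pM; rewrite ?mulr_ge0 //.
  by apply: ler_pM.
rewrite -exprD.
have := @exprz_bound _ p 0 (m + `|b|) (b * (b + m)) p0 p1.
by rewrite expr0 invr1 mul1r; apply; nia.
Qed.

Lemma durfee_const m : durfee m = durfee 0.
Proof.
have [c [c0 Hc]] := durfee_near.
have [d [d0 Hd]] := rp_bound p1.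
pose D m := durfee m - durfee (m + 1).
have Drec k : D k = - p ^ (k + 1) * D (k + 1).
  rewrite /D durfee_rec (_ : k + 1 + 1 = k + 2); last by ring.
  by ring.
have bd (k : nat) : `|durfee k| <= c + d.
  rewrite -(subrK (rp k) (durfee k)); apply: le_trans (ler_normD _ _) _.
  apply: lerD => //; apply: le_trans (Hc k) _.
  by rewrite ler_piMr // exprn_ile1 // ltW.
have bD (k : nat) : `|D k| <= 2 * (c + d).
  apply: le_trans (ler_normB _ _) _; rewrite mulrDl mul1r.
  by rewrite (_ : k%:Z + 1 = k.+1) ?lerD //; lia.
(* Iterating [Drec] n times gains a factor |p|^n at least, while the differences stay bounded;
   letting n grow forces them to vanish. *)
have bDn (n k : nat) : `|D k| <= `|p| ^+ n * (2 * (c + d)).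
  elim: n k => [|n IH] k; first by rewrite expr0 mul1r.
  rewrite Drec normrM normrN (_ : k%:Z + 1 = k.+1); last lia.
  rewrite exprS -mulrA; apply: ler_pM => //.
  rewrite normrXz -exprnP exprS ler_piMr //.
  by rewrite exprn_ile1 // ltW.
have D0 (k : nat) : D k = 0.
  apply/eqP; rewrite -normr_eq0 eq_le normr_ge0 andbT.
  rewrite real_leNgt ?real0 ?normr_real //; apply/negP => h.
  have e0 : 0 < `|D k| / (2 * (c + d) + 1).
    by rewrite divr_gt0 // ltr_wpDl // mulr_ge0 // addr_ge0.
  have [N] := expr_small (normr_ge0 p) p1 e0.
  rewrite ltr_pdivlMr; last by rewrite ltr_wpDl // mulr_ge0 // addr_ge0.
  have h3 : `|p| ^+ N * (2 * (c + d)) <= `|p| ^+ N * (2 * (c + d) + 1).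
    by rewrite ler_wpM2l ?exprn_ge0 // lerDl.
  by move=> h2; have := le_lt_trans (bDn N k) (le_lt_trans h3 h2); rewrite ltxx.
(* [Drec] expresses D k through D (k + 1), so vanishing descends to negative indices. *)
have Dm (k : nat) : D (- k%:Z) = 0.
  elim: k => [|k IH]; first by rewrite oppr0 D0.
  by rewrite Drec (_ : - k.+1%:Z + 1 = - k%:Z) ?IH ?mulr0 //; lia.
have St k : durfee (k + 1) = durfee k.
  apply/esym/eqP; rewrite -subr_eq0; apply/eqP.
  case: (ger0P k) => k0.
    by rewrite -(gez0_abs k0); exact: D0.
  by rewrite -[k]opprK -(ltz0_abs k0); exact: Dm.
exact: (int_shift_cst St).
Qed.

End Durfee.

(** * The products of Euler and Jacobi *)

Definition seqlim (K : numFieldType) (u : nat -> K) (l : K) :=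
  forall e : K, 0 < e -> exists N : nat, forall n : nat, (N <= n)%N -> `|l - u n| < e.

Lemma seqlim_cvg (K : numFieldType) (u : nat -> K) (l : K) :
  seqlim u l -> (u @ \oo --> l)%classic.
Proof.
by move=> ul; apply/cvgrPdist_lt => e /ul [N HN]; exists N.
Qed.

Lemma seqlim_limn (K : numFieldType) (u : nat -> K) (l : K) : seqlim u l -> limn u = l.
Proof. by move=> /seqlim_cvg ul; apply: cvg_lim => //; exact: norm_hausdorff. Qed.

Lemma seqlim_uniq (K : numFieldType) (u : nat -> K) (l l' : K) :
  seqlim u l -> seqlim u l' -> l = l'.
Proof. by move=> /seqlim_limn <- /seqlim_limn <-. Qed.

Lemma cvg_seqlim (K : numFieldType) (u : nat -> K) (l : K) :
  (u @ \oo --> l)%classic -> seqlim u l.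
Proof. by move=> /cvgrPdist_lt ul e /ul [N _ HN]; exists N. Qed.

Lemma seqlimM (K : numFieldType) (u v : nat -> K) (l m : K) :
  seqlim u l -> seqlim v m -> seqlim (fun n => u n * v n) (l * m).
Proof. by move=> /seqlim_cvg ul /seqlim_cvg vm; apply: cvg_seqlim; exact: cvgM. Qed.

Lemma seqlimV (K : numFieldType) (u : nat -> K) (l : K) :
  l != 0 -> seqlim u l -> seqlim (fun n => (u n)^-1) l^-1.
Proof. by move=> l0 /seqlim_cvg ul; apply: cvg_seqlim; exact: cvgV. Qed.

Lemma seqlim_cst (K : numFieldType) (l : K) : seqlim (fun=> l) l.
Proof. by move=> e e0; exists 0%N => n _; rewrite subrr normr0. Qed.

Lemma seqlim_sub (K : numFieldType) (u : nat -> K) (l : K) (h : nat -> nat) :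
  (forall n, (n <= h n)%N) -> seqlim u l -> seqlim (fun n => u (h n)) l.
Proof.
move=> hn ul e /ul [N HN]; exists N => n Nn.
by apply: HN; exact: leq_trans (hn n).
Qed.

Section Limits.
Context {R : realType}.
Local Notation K := R[i].

Lemma seqlim_geom (u : nat -> K) (l c x : K) : 0 <= c -> 0 <= x -> x < 1 ->
  (forall n, `|l - u n| <= c * x ^+ n) -> seqlim u l.
Proof.
move=> c0 x0 x1 H e e0.
have c1 : 0 < c + 1 by rewrite ltr_wpDl.
have [N HN] := expr_small x0 x1 (divr_gt0 e0 c1).
exists N => n Nn; apply: le_lt_trans (H n) _.
apply: (@le_lt_trans _ _ ((c + 1) * x ^+ N)); last by rewrite mulrC -ltr_pdivlMr.
apply: ler_pM; rewrite ?exprn_ge0 ?lerDl //.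
by apply: ler_wiXn2l => //; exact: ltW.
Qed.

End Limits.

Section Euler.
Context {R : realType}.
Local Notation K := R[i].
Variables (r : K) (r0 : 0 < `|r|) (r1 : `|r| < 1).
(** With a square root r of p, the exponents p^(a(a-1)/2) of Euler and Jacobi become integral powers
    of r. *)
Let p := r ^+ 2.

Let p0 : 0 < `|p|. Proof. by rewrite /p normrX exprn_gt0. Qed.
Let p1 : `|p| < 1. Proof. by rewrite /p normrX exprn_ilt1. Qed.
Let rn0 : r != 0. Proof. by rewrite -normr_gt0. Qed.
Let pn0 : p != 0. Proof. by rewrite -normr_gt0. Qed.
Let pE (a : int) : p ^ a = r ^ (2 * a). Proof. by rewrite /p exprnP exprz_exp. Qed.

(** Any k with |r|^k < 1/(|z| + 1) works: a linear amount of exponent pays for the growth of z^a. *)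
Lemma zpow_bound (z : K) : exists k : nat, forall a : nat, `|r ^ (k * a)%:Z * z ^+ a| <= 1.
Proof.
have z1 : 0 < `|z| + 1 by rewrite ltr_wpDl.
have e0 : 0 < (`|z| + 1)^-1 by rewrite invr_gt0.
have [k Hk] := expr_small (normr_ge0 r) r1 e0.
exists k => a; rewrite normrM -exprnP !normrX exprM -exprMn exprn_ile1 ?mulr_ge0 ?exprn_ge0 //.
apply: (@le_trans _ _ ((`|z| + 1)^-1 * (`|z| + 1))); last by rewrite mulVf // gt_eqF.
by apply: ler_pM; rewrite ?exprn_ge0 ?lerDl // ltW.
Qed.

Lemma asum_theta (z : K) : z != 0 ->
  asum (fun m : int => r ^ (m * (m - 1)) * (- z) ^ m).
Proof.
move=> z0; have [k Hk] := zpow_bound (- z); have [l Hl] := zpow_bound (- z)^-1.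
pose s := (k + l)%N.
(* The factor r^(s |m|), borrowed from the quadratic exponent, keeps (-z)^m bounded in both
   directions: k serves m >= 0 and l serves m < 0. *)
pose f (m : int) := r ^ (s%:Z * `|m|%N%:Z) * (- z) ^ m.
apply: eq_asum (_ : asum (fun m : int => r ^ (m * (m - 1) - s%:Z * `|m|%N%:Z) * f m)) => [m|].
  by rewrite /f mulrA -expfzDr // subrK.
apply: (@asum_exp _ _ (fun m => `|m|%N) _ 1 ((s + 2) ^ 2)%N) => //.
- by apply: asum_geom => //; exact: ltW.
- by move=> m _; exact: sqrB_ge_absz.
- have rs (x y : nat) : (x <= y)%N -> `|r ^ y%:Z| <= `|r ^ x%:Z|.
    by move=> xy; rewrite -!exprnP !normrX ler_wiXn2l // ltW.
  case=> m; rewrite /f.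
    apply: le_trans (Hk m); rewrite !normrM -exprnP ler_wpM2r //=.
    by rewrite -PoszM; apply: rs; rewrite leq_mul2r leq_addr orbT.
  apply: le_trans (Hl m.+1); rewrite !normrM /= exprVn ler_wpM2r //=.
  by rewrite -PoszM; apply: rs; rewrite leq_mul2r leq_addl orbT.
Qed.

(** Euler's series for (z; p)_oo. Negative indices contribute nothing, since [rqpoch] vanishes
    there. *)
Definition euler (z : K) : K :=
  usum (fun a : int => r ^ (a * (a - 1)) * ((- z) ^ a * rqpoch p a)).

Lemma asum_euler (z : K) : z != 0 ->
  asum (fun a : int => r ^ (a * (a - 1)) * ((- z) ^ a * rqpoch p a)).
Proof.
move=> z0; have [d [d0 Hd]] := rp_bound p1.
apply: asum_le (asum_theta z0) => [|a]; first exact: d0.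
by rewrite mulrA [leLHS]normrM mulrC ler_wpM2r.
Qed.

(** Write 1 = p^a + (1 - p^a) in each term: the first part is the series at z p, the second lowers
    the index of [rqpoch] and is -z times the same series after a shift. *)
Lemma euler_rec (z : K) : z != 0 -> euler z = (1 - z) * euler (z * p).
Proof.
move=> z0; have zp0 : z * p != 0 by rewrite mulf_neq0.
have nz0 : - z != 0 by rewrite oppr_eq0.
pose T a := r ^ (a * (a - 1)) * ((- (z * p)) ^ a * rqpoch p a).
have Ts : asum T by exact: asum_euler.
pose B (a : int) := r ^ (a * (a - 1)) * ((- z) ^ a * rqpoch p (a - 1)).
have BE (a : int) : B (a + 1) = - z * T a.
  rewrite /B /T addrK -mulNr expfzMl pE expfzDr // expr1z.
  rewrite (_ : (a + 1) * a = a * (a - 1) + 2 * a); last by ring.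
  by rewrite expfzDr //; ring.
have Bs : asum (fun a => B (a + 1)).
  by apply: eq_asum (asumZ (- z) Ts) => a; rewrite BE.
have BK : cancel (fun b : int => b - 1) (fun b => b + 1) by move=> b; rewrite subrK.
have KB : cancel (fun b : int => b + 1) (fun b => b - 1) by move=> b; rewrite addrK.
have EB : usum B = - z * euler (z * p).
  by rewrite (usum_bij KB BK Bs) -usumZ //; apply: eq_usum => a; rewrite BE.
have {}Bs : asum B by exact: asum_bij BK Bs.
have -> : euler z = usum (fun a => T a + B a).
  apply: eq_usum => a; rewrite /T /B rp_pred // -mulNr expfzMl; ring.
by rewrite usumD // EB /T -/(euler (z * p)); ring.
Qed.

(** Continuity at 0 with a linear rate: the term a = 0 is 1, and every term with a > 0 contains a
    factor y. *)
Lemma euler_near : exists c : K, 0 <= c /\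
  forall y : K, y != 0 -> `|y| <= 1 -> `|1 - euler y| <= c * `|y|.
Proof.
have le1 (m : int) : 1 <= m -> m - 1%N%:Z <= m * (m - 1).
  by nia.
have [d [d0 Hd]] := rp_bound p1.
have [c Hc] := asum_geom (ltW r0) r1.
have c0 : 0 <= c by have := Hc fset0; rewrite big_seq_fset0.
exists (`|r| ^- 1 * d * c); split; first by rewrite !mulr_ge0 // invr_ge0 exprn_ge0.
move=> y y0 y1.
pose f (a : int) : K := r ^ (a * (a - 1)) * ((- y) ^ a * rqpoch p a).
pose g (a : int) : K := (a != 0)%:R * f a.
pose h (a : int) : K := (a == 0)%:R * f a.
have fs : asum f by exact: asum_euler.
have gs : asum g.
  apply: asum_le fs => [|a]; first exact: ler01.
  by rewrite normrM ler_wpM2r // normr_nat lern1 leq_b1.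
have hs : asum h.
  apply: asum_le fs => [|a]; first exact: ler01.
  by rewrite normrM ler_wpM2r // normr_nat lern1 leq_b1.
have -> : euler y = 1 + usum g.
  rewrite (_ : 1 = usum h); last first.
    rewrite (usum1 (x := 0)); first by rewrite /h /f eqxx !expr0z rp0 !mul1r.
    by move=> a /negPf a0; rewrite /h a0 mul0r.
  rewrite -usumD //; apply: eq_usum => a; rewrite /g /h -mulrDl -natrD.
  by case: (a == 0); rewrite mul1r.
rewrite opprD addNKr normrN.
apply: ler_usum => // A.
apply: (@le_trans _ _ (`|r| ^- 1 * d * `|y| * \sum_(b <- A) `|(`|r| ^+ `|b|)|)); last first.
  by rewrite mulrAC ler_wpM2r // ler_wpM2l // mulr_ge0 // invr_ge0 exprn_ge0.
rewrite mulr_sumr; apply: ler_sum => a _.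
rewrite (ger0_norm (exprn_ge0 _ (normr_ge0 r))) /g.
have rhs0 : 0 <= `|r| ^- 1 * d * `|y| * `|r| ^+ `|a|.
  by rewrite !mulr_ge0 ?exprn_ge0 // invr_ge0 exprn_ge0.
have [->|a0] := eqVneq a 0; first by rewrite mul0r normr0 !mulr_ge0 ?invr_ge0 ?exprn_ge0.
rewrite mul1r /f; case: a a0 rhs0 => [[|n]|n] // _ rhs0; last by rewrite /= !mulr0 normr0.
rewrite 2!normrM.
have -> : `|r| ^- 1 * d * `|y| * `|r| ^+ `|n.+1|%N =
    `|r| ^- 1 * `|r| ^+ n.+1 * (`|y| * d) by rewrite /=; ring.
apply: ler_pM; rewrite ?mulr_ge0 //.
  have e : n.+1%:Z - 1%N%:Z <= n.+1%:Z * (n.+1%:Z - 1) := le1 n.+1%:Z isT.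
  exact: (@exprz_bound _ r 1 n.+1 _ r0 r1 e).
apply: ler_pM => //.
by rewrite -exprnP normrX normrN exprS ler_piMr // exprn_ile1.
Qed.

Lemma qpoch_euler (z : K) n : z != 0 -> qpoch z p n * euler (z * p ^+ n) = euler z.
Proof.
move=> z0; elim: n => [|n <-].
  by rewrite /qpoch big_ord0 expr0 mulr1 mul1r.
rewrite qpochS [in RHS]euler_rec; last by rewrite mulf_neq0 // expf_neq0.
by rewrite exprSr !mulrA.
Qed.

(** By [qpoch_euler] the partial product is the quotient of [euler z] by [euler (z p^n)], and the
    denominator tends to 1. *)
Lemma seqlim_qpoch (z : K) : z != 0 -> seqlim (fun n => qpoch z p n) (euler z).
Proof.
move=> z0; have [c [c0 Hc]] := euler_near.
have E1 : seqlim (fun n => euler (z * p ^+ n)) 1.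
  have nz : 0 < `|z| by rewrite normr_gt0.
  have e0 : 0 < `|z|^-1 by rewrite invr_gt0.
  have [N HN] := expr_small (normr_ge0 p) p1 e0.
  have H n : (N <= n)%N -> `|1 - euler (z * p ^+ n)| <= c * `|z| * `|p| ^+ n.
    move=> Nn; rewrite -mulrA -normrX -normrM; apply: Hc.
      by rewrite mulf_neq0 // expf_neq0.
    rewrite normrM mulrC -ler_pdivlMr // mul1r; apply: le_trans (ltW HN).
    by rewrite normrX ler_wiXn2l // ltW.
  move=> e e'0.
  have c1 : 0 < c * `|z| + 1 by rewrite ltr_wpDl // mulr_ge0.
  have [M HM] := expr_small (normr_ge0 p) p1 (divr_gt0 e'0 c1).
  exists (maxn N M) => n; rewrite geq_max => /andP[Nn Mn].
  apply: le_lt_trans (H _ Nn) _.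
  apply: (@le_lt_trans _ _ ((c * `|z| + 1) * `|p| ^+ M)); last by rewrite mulrC -ltr_pdivlMr.
  apply: ler_pM; rewrite ?exprn_ge0 ?lerDl ?mulr_ge0 //.
  by apply: ler_wiXn2l => //; exact: ltW.
have := seqlimV (oner_neq0 _) E1; rewrite invr1.
move=> /(seqlimM (seqlim_cst (euler z))); rewrite mulr1 => H.
move=> e e0; have [N HN] := H e e0.
(* Beyond [M] the denominator is at distance less than 1 from 1, hence nonzero, and the division is
   legitimate. *)
have [M HM] := E1 _ (ltr01 : (0 : K) < 1).
exists (maxn N M) => n; rewrite geq_max => /andP[Nn Mn].
have en0 : euler (z * p ^+ n) != 0.
  by apply: contraTneq (HM n Mn) => ->; rewrite subr0 normr1 ltxx.
by have := HN n Nn; rewrite -[in X in _ - X](qpoch_euler n z0) mulfK.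
Qed.

Lemma qpoch_infE (z : K) : z != 0 -> qpoch_inf z p = euler z.
Proof. by move=> /seqlim_qpoch /seqlim_limn. Qed.

(** By [durfee_near] the reciprocals 1/(p)_n are asymptotic to [durfee n], which is constant. *)
Lemma durfee0_qpoch_inf : durfee p 0 * qpoch_inf p p = 1.
Proof.
have [c [c0 Hc]] := durfee_near p0 p1.
have H : seqlim (fun n : nat => rqpoch p n) (durfee p 0).
  apply: (seqlim_geom c0 (ltW p0) p1) => n.
  by have := Hc n; rewrite durfee_const.
rewrite qpoch_infE //; apply: seqlim_uniq (seqlimM H (seqlim_qpoch pn0)) _.
have := seqlim_cst (1 : K); congr seqlim; apply/funext => n.
by rewrite /= mulVf // qpoch_neq0.
Qed.

Lemma qpoch_inf_neq0 : qpoch_inf p p != 0.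
Proof.
by apply/eqP => h; have := durfee0_qpoch_inf; rewrite h mulr0 => /esym/eqP; rewrite oner_eq0.
Qed.

(** Multiply Euler's series for z and p/z and collect the terms whose indices b + m and b have
    difference m. The sum over b is [durfee m], independent of m, and cancels against (p; p)_oo. *)
Lemma jacobi_triple (z : K) : z != 0 ->
  usum (fun m : int => r ^ (m * (m - 1)) * (- z) ^ m) =
  qpoch_inf z p * qpoch_inf (p / z) p * qpoch_inf p p.
Proof.
move=> z0; have pz0 : p / z != 0 by rewrite mulf_neq0 // invr_neq0.
have nz0 : - z != 0 by rewrite oppr_eq0.
rewrite !(qpoch_infE z0) (qpoch_infE pz0).
rewrite (usumM (asum_euler z0) (asum_euler pz0)).
set F := fun x : int * int => _.
have Fs : asum F := asum_prod (asum_euler z0) (asum_euler pz0).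
pose h (x : int * int) := (x.2 + x.1, x.2).
pose h' (x : int * int) := (x.1 - x.2, x.2).
have hK : cancel h h' by case=> a b; rewrite /h /h' /= addrAC subrr add0r.
have h'K : cancel h' h by case=> a b; rewrite /h /h' /= addrC subrK.
have FE (m b : int) : F (h (m, b)) =
    r ^ (m * (m - 1)) * (- z) ^ m * (p ^ (b * (b + m)) * (rqpoch p b * rqpoch p (b + m))).
  rewrite /F /h /= pE [(- z) ^ (b + m)]expfzDr //.
  have -> : - (p / z) = p / (- z) by rewrite invrN mulrN.
  rewrite expfzMl exprz_inv pE.
  have e : (- z) ^ (- b) * (- z) ^ b = 1 by rewrite -expfzDr // addNr.
  rewrite [LHS](_ : _ = (r ^ ((b + m) * (b + m - 1)) * r ^ (b * (b - 1)) * r ^ (2 * b)) *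
    ((- z) ^ (- b) * (- z) ^ b) * (- z) ^ m * (rqpoch p b * rqpoch p (b + m))); last by ring.
  rewrite e mulr1 -!expfzDr // [RHS]mulrA [X in _ = X * _]mulrAC -expfzDr //.
  by congr (r ^ _ * _ * _); ring.
have Fhs : asum (fun x => F (h x)) by apply: asum_comp Fs; exact: can_inj hK.
rewrite (usum_bij hK h'K Fhs) usum_fubini //.
under [X in _ = X * _]eq_usum => m.
  under eq_usum => b do rewrite FE.
  rewrite usumZ; last exact: asum_durfee0.
  rewrite -/(durfee p m) durfee_const // mulrC; over.
rewrite usumZ; last exact: asum_theta.
by rewrite mulrAC durfee0_qpoch_inf mul1r.
Qed.

End Euler.

(** * The theta transform *)

Section ShiftedDurfee.
Context {R : realType}.
Local Notation K := R[i].
Variables (p : K) (p0 : 0 < `|p|) (p1 : `|p| < 1).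
Local Notation rp := (rqpoch p).

Let pn0 : p != 0. Proof. by rewrite -normr_gt0. Qed.

Lemma rp_neq0 a : rp a != 0 -> 0 <= a.
Proof. by case: a => // n; rewrite /= eqxx. Qed.

Lemma rp2_neq0 (x : K) a b : x * (rp a * rp b) != 0 -> 0 <= a /\ 0 <= b.
Proof. by rewrite !mulf_eq0 !negb_or => /andP[_ /andP[/rp_neq0 ? /rp_neq0 ?]]. Qed.

Lemma asum_binomial (m k : int) :
  asum (fun n : int => p ^ (m * n - n * (k - n)) * (rp n * rp (k - n))).
Proof.
have [d [d0 Hd]] := rp_bound p1.
apply: (@asum_exp _ _ (fun n => `|n|%N) _ (d * d) (`|m| * `|k| + `|k| * `|k| + `|k|)%N) => //.
- by apply: asum_geom => //; exact: ltW.
- move=> n; rewrite -[rp n * _]mul1r => /rp2_neq0[n0 nk].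
  have : n * (k - n) <= k * k by nia.
  have : m * n >= - (`|m|%N%:Z * `|k|%N%:Z) by nia.
  by nia.
- by move=> b; rewrite normrM ler_pM.
Qed.

Let dd (m k : int) := usum (fun b : int => p ^ (b * (b + m) - b * k) * (rp b * rp (b + m))).
Let ee (m k : int) := usum (fun n : int => p ^ (m * n - n * (k - n)) * (rp n * rp (k - n))).

Let BK : cancel (fun b : int => b - 1) (fun b => b + 1).
Proof. by move=> b; rewrite subrK. Qed.
Let KB : cancel (fun b : int => b + 1) (fun b => b - 1).
Proof. by move=> b; rewrite addrK. Qed.

(** Again 1 = p^b + (1 - p^b), the second part being shifted in b. The recurrence lowers k and
    matches [ee_rec] up to the factor 1 - p^k that relates rp k to rp (k - 1). *)
Let dd_rec (m k : int) : dd m k = dd m (k - 1) + p ^ (m + 1 - k) * dd (m + 1) (k - 1).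
Proof.
pose B (b : int) := p ^ (b * (b + m) - b * k) * (rp (b - 1) * rp (b + m)).
have BE (b : int) : B (b + 1) = p ^ (m + 1 - k) *
    (p ^ (b * (b + (m + 1)) - b * (k - 1)) * (rp b * rp (b + (m + 1)))).
  rewrite /B addrK [RHS]mulrA -expfzDr //; congr (_ ^ _ * (_ * rp _)); ring.
have Bs : asum (fun b => B (b + 1)).
  apply: eq_asum (asumZ (p ^ (m + 1 - k)) (asum_durfee p0 p1 (m + 1) (k - 1))) => b.
  by rewrite BE.
rewrite /dd -[X in _ = _ + X]usumZ; last exact: asum_durfee.
have <- : usum B = usum (fun b : int => p ^ (m + 1 - k) *
    (p ^ (b * (b + (m + 1)) - b * (k - 1)) * (rp b * rp (b + (m + 1))))).
  by rewrite (usum_bij KB BK Bs); exact: eq_usum.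
rewrite -usumD; [|exact: asum_durfee|exact: asum_bij BK Bs].
apply: eq_usum => b; rewrite /B rp_pred //.
have -> : b * (b + m) - b * (k - 1) = (b * (b + m) - b * k) + b by ring.
set e := _ - _; rewrite (@expfzDr _ _ e b) //; ring.
Qed.

(** A q-Pascal rule, from 1 - p^k = p^n (1 - p^(k-n)) + (1 - p^n). *)
Let ee_rec (m k : int) :
  (1 - p ^ k) * ee m k = ee m (k - 1) + p ^ (m + 1 - k) * ee (m + 1) (k - 1).
Proof.
pose B (n : int) := p ^ (m * n - n * (k - n)) * (rp (n - 1) * rp (k - n)).
have BE (n : int) : B (n + 1) = p ^ (m + 1 - k) *
    (p ^ ((m + 1) * n - n * (k - 1 - n)) * (rp n * rp (k - 1 - n))).
  rewrite /B addrK [RHS]mulrA -expfzDr //; congr (_ ^ _ * (_ * rp _)); ring.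
have Bs : asum (fun n => B (n + 1)).
  by apply: eq_asum (asumZ (p ^ (m + 1 - k)) (asum_binomial (m + 1) (k - 1))) => n; rewrite BE.
rewrite /ee -[LHS]usumZ; last exact: asum_binomial.
rewrite -[X in _ = _ + X]usumZ; last exact: asum_binomial.
have <- : usum B = usum (fun n : int => p ^ (m + 1 - k) *
    (p ^ ((m + 1) * n - n * (k - 1 - n)) * (rp n * rp (k - 1 - n)))).
  by rewrite (usum_bij KB BK Bs); exact: eq_usum.
rewrite -usumD; [|exact: asum_binomial|exact: asum_bij BK Bs].
apply: eq_usum => n; rewrite /B rp_pred //.
have -> : k - 1 - n = (k - n) - 1 by ring.
rewrite rp_pred //.
have -> : m * n - n * (k - n - 1) = (m * n - n * (k - n)) + n by ring.
set e := m * n - _.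
have -> : p ^ k = p ^ n * p ^ (k - n) by rewrite -expfzDr //; congr (_ ^ _); ring.
rewrite (@expfzDr _ _ e n) //; ring.
Qed.

(* For [k] >= 0, dividing by [rp k] gives q-binomial coefficients on the right;
   both sides vanish for [k] < 0. *)
Lemma durfee_binomial (m k : int) :
  rp k * usum (fun b : int => p ^ (b * (b + m) - b * k) * (rp b * rp (b + m))) =
  durfee p 0 * usum (fun n : int => p ^ (m * n - n * (k - n)) * (rp n * rp (k - n))).
Proof.
rewrite -/(dd m k) -/(ee m k); case: k => k; last first.
  rewrite mul0r /ee usum0 ?mulr0 // => n.
  apply/eqP/negPn/negP => /rp2_neq0[]; lia.
(* m stays general in the induction on k, because the recurrences also use m + 1. *)
elim: k m => [|k IH] m.
  rewrite rp0 mul1r -[in RHS](durfee_const p0 p1 m) /dd /durfee.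
  rewrite [X in _ = _ * X](_ : _ = 1) ?mulr1.
    by apply: eq_usum => b; rewrite mulr0 subr0.
  rewrite /ee (usum1 (x := 0)); first by rewrite mulr0 mul0r subr0 expr0z rp0 !mul1r.
  move=> n n0; apply/eqP/negPn/negP => /rp2_neq0[]; lia.
have nz : 1 - p ^ k.+1%:Z != 0.
  by apply: normr_lt1_subr_neq0; rewrite normrXz -exprnP exprn_ilt1.
have kE : k.+1%:Z - 1 = k by lia.
apply: (mulfI nz); rewrite mulrA -rp_pred // dd_rec mulrCA ee_rec kE.
by rewrite !mulrDr IH mulrCA IH mulrCA.
Qed.

End ShiftedDurfee.

(** On the support the index i = u + 2b is nonnegative and controls both |u| and |b|, although the
    exponent depends on i alone. *)
Lemma transform_exp_ge (u b j : int) : 0 <= u + b -> 0 <= b ->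
  (`|u| + `|b|)%N%:Z - (4 * `|j|.+1 ^ 2)%N%:Z <=
  (u + 2 * b) * (u + 2 * b) - 2 * (u + 2 * b) * j.
Proof.
rewrite -mulnn => ub b0; have : (`|u| + `|b|)%N%:Z <= 2 * (u + 2 * b) by lia.
have : u + 2 * b >= 0 by lia.
move: (u + 2 * b) => i i0; move: (_ + _)%N => t; clear u b ub b0.
have := @mul_ge_linear j (- i) `|i|%N; rewrite abszN leqnn => /(_ isT).
have := sqr_ge_linear (2 * (`|j| + 1))%N i; rewrite -addn1.
have : `|i|%N%:Z = i by lia.
by move: `|j|%N => s; move: `|i|%N => x ->; lia.
Qed.

Lemma swapped_exp_ge (u n j : int) : 0 <= n -> 0 <= j - n ->
  (`|u| + `|n|)%N%:Z - (`|j| * `|j| + 2 * `|j|)%N%:Z <=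
  (u + (2 * n - j)) * (u + (2 * n - j)) - j * j.
Proof.
move=> n0 jn; have := absz_le_sqr (u + (2 * n - j)).
rewrite !PoszD !PoszM (_ : j * j = `|j|%N%:Z * `|j|%N%:Z); last by clear; nia.
move: (`|j|%N%:Z * `|j|%N%:Z) ((u + (2 * n - j)) * (u + (2 * n - j))) => a b; lia.
Qed.

Section ThetaTransform.
Context {R : realType}.
Local Notation K := R[i].
Variables (q : K) (q0 : 0 < `|q|) (q1 : `|q| < 1).
Local Notation p := (q ^+ 4).
Local Notation rp := (rqpoch p).

Let qn0 : q != 0. Proof. by rewrite -normr_gt0. Qed.
Let p0 : 0 < `|p|. Proof. by rewrite normrX exprn_gt0. Qed.
Let p1 : `|p| < 1. Proof. by rewrite normrX exprn_ilt1. Qed.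
Let pE (a : int) : p ^ a = q ^ (4 * a). Proof. by rewrite exprnP exprz_exp. Qed.

Definition bounded (B : int -> K) := exists d : K, forall u, `|B u| <= d.

(** The convolution of [B] with the coefficients q^(x^2) of theta, taken at -w. *)
Definition thetaT (B : int -> K) (w : int) : K :=
  usum (fun x : int => q ^ (x * x) * B (x - w)).

(* Up to the factor 1/(p)_i, the sum of [i choose a]_p B(2a - i). *)
Definition binomT (B : int -> K) (i : int) : K :=
  usum (fun a : int => rp a * rp (i - a) * B (2 * a - i)).

Lemma asum_binomT (B : int -> K) i : bounded B ->
  asum (fun a : int => rp a * rp (i - a) * B (2 * a - i)).
Proof.
move=> [d Bd]; have [e [e0 He]] := rp_bound p1.
have := @asum_exp _ _ (fun a => `|a|%N) q (e * e * d) `|i|%N (fun=> 0)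
  (fun a : int => rp a * rp (i - a) * B (2 * a - i)) q0 q1 (asum_geom (ltW q0) q1).
move=> H; apply: eq_asum (H _ _) => [a|a|a]; first by rewrite expr0z mul1r.
  by rewrite !mulf_eq0 !negb_or => /andP[/andP[/rp_neq0 ? /rp_neq0 ?] _]; lia.
by rewrite !normrM; apply: ler_pM; rewrite ?mulr_ge0 //; exact: ler_pM.
Qed.

Lemma asum_thetaT B w : bounded B -> asum (fun x : int => q ^ (x * x) * B (x - w)).
Proof.
move=> [d Bd]; apply: (@asum_exp _ _ (fun x => `|x|%N) _ d 0%N) => //.
- by apply: asum_geom => //; exact: ltW.
- by move=> x _; nia.
Qed.

Lemma bounded_thetaT B : bounded B -> bounded (thetaT B).
Proof.
move=> Bb; have [d Bd] := Bb.
have d0 : 0 <= d by apply: le_trans (Bd 0).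
have [c Hc] := asum_geom (ltW q0) q1.
exists (c * d) => w; apply: ler_usum; first exact: asum_thetaT.
move=> A.
have c0 : 0 <= c by have := Hc fset0; rewrite big_seq_fset0.
apply: le_trans (ler_wpM2r d0 (Hc A)).
rewrite mulr_suml; apply: ler_sum => x _.
rewrite normrM; apply: ler_pM => //.
rewrite (ger0_norm (exprn_ge0 _ (normr_ge0 q))).
have := @exprz_bound _ q 0 `|x| (x * x) q0 q1.
rewrite expr0 invr1 mul1r; apply.
by rewrite subr0; exact: absz_le_sqr.
Qed.

(** The coordinates u = 2a - i and b = i - a separate the argument of [B] from a Durfee summation
    index. *)
Let hT (x : int * int) := (x.1 + 2 * x.2, x.1 + x.2).
Let hT' (x : int * int) := (2 * x.2 - x.1, x.1 - x.2).
Let hTK : cancel hT hT'.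
Proof. by move=> [u b]; rewrite /hT /hT' /=; congr (_, _); ring. Qed.
Let hT'K : cancel hT' hT.
Proof. by move=> [u b]; rewrite /hT /hT' /=; congr (_, _); ring. Qed.

Let F (B : int -> K) (j : int) (x : int * int) : K :=
  q ^ (x.1 * x.1 - 2 * x.1 * j) * (rp x.2 * rp (x.1 - x.2) * B (2 * x.2 - x.1)).

Let FE B j (u b : int) : F B j (hT (u, b)) = q ^ (u * u - 2 * u * j) * B u *
    (p ^ (b * (b + u) - b * j) * (rp b * rp (b + u))).
Proof.
rewrite /F /hT /= pE.
have -> : u + 2 * b - (u + b) = b by ring.
have -> : 2 * (u + b) - (u + 2 * b) = u by ring.
rewrite [u + b]addrC.
have -> : (u + 2 * b) * (u + 2 * b) - 2 * (u + 2 * b) * j =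
  (u * u - 2 * u * j) + 4 * (b * (b + u) - b * j) by ring.
rewrite expfzDr //; ring.
Qed.

Let asum_FhT B j : bounded B -> asum (fun x => F B j (hT x)).
Proof.
move=> [d Bd]; have [e [e0 He]] := rp_bound p1.
apply: (@asum_exp _ _ (fun x => `|x.1| + `|x.2|)%N _ (e * e * d) (4 * `|j|.+1 ^ 2)%N) => //.
- by apply: asum_geom2 => //; exact: ltW.
- move=> [u b] /= H.
  have [a0 b0] : 0 <= u + b /\ 0 <= b.
    move: H; rewrite !mulf_eq0 !negb_or (_ : u + 2 * b - (u + b) = b); last by ring.
    by case/andP=> /andP[/rp_neq0 ? /rp_neq0 ?] _.
  exact: transform_exp_ge.
- move=> [u b]; rewrite !normrM; apply: ler_pM; rewrite ?mulr_ge0 //.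
  exact: ler_pM.
Qed.

Let asum_F B j : bounded B -> asum (F B j).
Proof. by move=> Bb; apply: asum_bij hT'K (asum_FhT j Bb). Qed.

Let usum_F B j i : bounded B ->
  usum (fun a => F B j (i, a)) = q ^ (i * i - 2 * i * j) * binomT B i.
Proof. by move=> Bb; rewrite /F /= usumZ //; exact: asum_binomT. Qed.

Lemma asum_expr_binomT B j : bounded B ->
  asum (fun i : int => q ^ (i * i - 2 * i * j) * binomT B i).
Proof.
move=> Bb; apply: eq_asum (asum_usum (asum_F j Bb)) => i; exact: usum_F.
Qed.

(** For fixed u = 2a - i the sum over the other index is a shifted Durfee sum, which
    [durfee_binomial] turns into a sum over n with q-binomial weight in j and n. The exponent
    becomes (u + 2n - j)^2 - j^2, so summing over u first yields [thetaT B] at 2n - j. *)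
Lemma binomT_theta (B : int -> K) (j : int) : bounded B ->
  rp j * usum (fun i : int => q ^ (i * i - 2 * i * j) * binomT B i) =
  durfee p 0 * q ^ (- (j * j)) * binomT (thetaT B) j.
Proof.
move=> Bb; have [d Bd] := Bb.
have d0 : 0 <= d by apply: le_trans (Bd 0).
have [e [e0 He]] := rp_bound p1.
have g2 := asum_geom2 (ltW q0) q1.
have Fs := asum_F j Bb; have Fhs := asum_FhT j Bb.
pose G (x : int * int) : K :=
  q ^ ((x.1 + (2 * x.2 - j)) * (x.1 + (2 * x.2 - j)) - j * j) *
  (B x.1 * (rp x.2 * rp (j - x.2))).
have Gs : asum G.
  apply: (@asum_exp _ _ (fun x => `|x.1| + `|x.2|)%N _ (d * (e * e))
    (`|j| * `|j| + 2 * `|j|)%N) => //.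
  - move=> [u n] /= /rp2_neq0[n0 jn].
    exact: swapped_exp_ge.
  - move=> [u b]; rewrite !normrM; apply: ler_pM; rewrite ?mulr_ge0 //.
    exact: ler_pM.
rewrite -(eq_usum (fun i => usum_F j i Bb)) -(usum_fubini Fs).
rewrite (usum_bij hTK hT'K Fhs) usum_fubini //.
have -> : rp j * usum (fun u => usum (fun b => F B j (hT (u, b)))) = durfee p 0 * usum G.
  rewrite (usum_fubini Gs) -!usumZ; first last.
  - exact: (asum_usum Fhs).
  - exact: (asum_usum Gs).
  apply: eq_usum => u.
  rewrite (eq_usum (FE B j u)) usumZ; last exact: asum_durfee.
  rewrite mulrCA durfee_binomial // mulrCA; congr (_ * _).
  rewrite -usumZ; last exact: asum_binomial.
  apply: eq_usum => n; rewrite /G /= pE.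
  have -> : (u + (2 * n - j)) * (u + (2 * n - j)) - j * j =
    (u * u - 2 * u * j) + 4 * (u * n - n * (j - n)) by ring.
  rewrite (@expfzDr _ q (u * u - 2 * u * j)) //; ring.
rewrite -mulrA; congr (_ * _).
rewrite usum_swap // /binomT -usumZ; last exact/asum_binomT/bounded_thetaT.
apply: eq_usum => n; rewrite /G /thetaT /=.
have KB : cancel (fun x : int => x - (2 * n - j)) (fun x => x + (2 * n - j)).
  by move=> x; rewrite subrK.
have BK : cancel (fun x : int => x + (2 * n - j)) (fun x => x - (2 * n - j)).
  by move=> x; rewrite addrK.
rewrite mulrA -usumZ; last exact: asum_thetaT.
have Hs := asumZ (q ^ (- (j * j)) * (rp n * rp (j - n))) (asum_thetaT (2 * n - j) Bb).
rewrite (usum_bij KB BK); last first.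
  apply: eq_asum Hs => x; rewrite subrK expfzDr //; ring.
apply: eq_usum => x; rewrite subrK expfzDr //; ring.
Qed.

End ThetaTransform.

(** * Schur's finite pentagonal identity and three theta transforms *)

Section SchurSequence.
Context {R : realType}.
Local Notation K := R[i].
Variables (q : K) (q0 : 0 < `|q|) (q1 : `|q| < 1).
Local Notation p := (q ^+ 4).
Local Notation rp := (rqpoch p).

Let qn0 : q != 0. Proof. by rewrite -normr_gt0. Qed.
Let p0 : 0 < `|p|. Proof. by rewrite normrX exprn_gt0. Qed.
Let p1 : `|p| < 1. Proof. by rewrite normrX exprn_ilt1. Qed.
Let pE (a : int) : p ^ a = q ^ (4 * a). Proof. by rewrite exprnP exprz_exp. Qed.

(* B(3n) = 0, B(3n+1) = (-1)^n q^(6n^2-2n), B(3n+2) = (-1)^n q^(6n^2+2n). *)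
Definition schur_seq (s : int) : K :=
  if (s %% 3)%Z == 0 then 0
  else (-1) ^ (s %/ 3)%Z *
    q ^ (6 * (s %/ 3)%Z * (s %/ 3)%Z + (4 * (s %% 3)%Z - 6) * (s %/ 3)%Z).

Let divmod3 (n e : int) : 0 <= e < 3 ->
  ((3 * n + e) %/ 3)%Z = n /\ ((3 * n + e) %% 3)%Z = e.
Proof.
move=> he; rewrite mulrC; split; last by rewrite modzMDl modz_small.
by rewrite divzMDl // divz_small ?addr0.
Qed.

Lemma schur_seq_0 n : schur_seq (3 * n) = 0.
Proof. by rewrite /schur_seq -[3 * n]addr0; have [_ ->] := @divmod3 n 0 isT. Qed.

Lemma schur_seq_1 n : schur_seq (3 * n + 1) = (-1) ^ n * q ^ (6 * n * n - 2 * n).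
Proof.
rewrite /schur_seq; have [-> ->] := @divmod3 n 1 isT => /=.
by congr (_ * _ ^ _); ring.
Qed.

Lemma schur_seq_2 n : schur_seq (3 * n + 2) = (-1) ^ n * q ^ (6 * n * n + 2 * n).
Proof.
rewrite /schur_seq; have [-> ->] := @divmod3 n 2 isT => /=.
by congr (_ * _ ^ _); ring.
Qed.

Lemma signzN n : (-1 : K) ^ (- n) = (-1) ^ n.
Proof. by rewrite -exprz_inv invrN1. Qed.

Lemma signzS n : (-1 : K) ^ (n + 1) = - (-1) ^ n.
Proof. by rewrite expfzDr ?oppr_eq0 ?oner_eq0 // expr1z mulrN1. Qed.

Lemma normr_signz n : `|(-1 : K) ^ n| = 1.
Proof. by rewrite normrXz normrN normr1 exp1rz. Qed.

Lemma schur_seq_refl s : schur_seq (3 - s) = schur_seq s.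
Proof.
have [n [->|->|->]] := int_mod3 s.
- by rewrite (_ : 3 - 3 * n = 3 * (1 - n)) ?schur_seq_0 //; ring.
- rewrite (_ : 3 - (3 * n + 1) = 3 * (- n) + 2); last by ring.
  by rewrite schur_seq_1 schur_seq_2 signzN; congr (_ * _ ^ _); ring.
- rewrite (_ : 3 - (3 * n + 2) = 3 * (- n) + 1); last by ring.
  by rewrite schur_seq_1 schur_seq_2 signzN; congr (_ * _ ^ _); ring.
Qed.

Lemma schur_seqN s : schur_seq (- s) = - (p ^ s * schur_seq s).
Proof.
rewrite pE; have [n [->|->|->]] := int_mod3 s.
- by rewrite -mulrN !schur_seq_0 mulr0 oppr0.
- rewrite (_ : - (3 * n + 1) = 3 * (- (n + 1)) + 2); last by ring.
  rewrite schur_seq_1 schur_seq_2 signzN signzS mulrCA -expfzDr // mulNr.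
  by congr (- (_ * _ ^ _)); ring.
- rewrite (_ : - (3 * n + 2) = 3 * (- (n + 1)) + 1); last by ring.
  rewrite schur_seq_1 schur_seq_2 signzN signzS mulrCA -expfzDr // mulNr.
  by congr (- (_ * _ ^ _)); ring.
Qed.

Lemma schur_seq_bound s : `|schur_seq s| <= 1.
Proof.
have H (e : int) : 0 <= e -> `|q ^ e| <= 1.
  by case: e => // e _; rewrite normrXz -exprnP exprn_ile1 // ltW.
have [n [->|->|->]] := int_mod3 s.
- by rewrite schur_seq_0 normr0.
- by rewrite schur_seq_1 normrM normr_signz mul1r; apply: H; nia.
- by rewrite schur_seq_2 normrM normr_signz mul1r; apply: H; nia.
Qed.

Lemma bounded_schur_seq : bounded schur_seq.
Proof. by exists 1; exact: schur_seq_bound. Qed.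

Let bounded_schur_seqD k : bounded (fun r => schur_seq (r + k)).
Proof. by exists 1 => s; exact: schur_seq_bound. Qed.

Let Zterm i a := p ^ a * (rp a * rp (i - a) * schur_seq (2 * a - i)).

Let asum_Z i : asum (Zterm i).
Proof.
apply: asum_le (asum_binomT q0 q1 i bounded_schur_seq) => [|a]; first exact: ler01.
rewrite normrM; have [a0|a0] := boolP (0 <= a).
  apply: ler_pM => //; case: a a0 => // a _.
  by rewrite normrXz -exprnP exprn_ile1 // ltW.
have -> : rp a = 0 by rewrite rp_neg // ltNge.
by rewrite !mul0r normr0 !mulr0.
Qed.

Let reflK (i : int) : cancel (fun a => i - a) (fun a => i - a).
Proof. by move=> a; ring. Qed.

(** By [schur_seqN] the reflection a -> i - a changes the sign of each term, so the sum equals its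
    own negative. *)
Let usum_Z i : usum (Zterm i) = 0.
Proof.
have ZN a : Zterm i (i - a) = -1 * Zterm i a.
  rewrite /Zterm (_ : i - (i - a) = a); last by ring.
  rewrite (_ : 2 * (i - a) - i = - (2 * a - i)); last by ring.
  rewrite schur_seqN (_ : p ^ (i - a) * _ = - ((p ^ (i - a) * p ^ (2 * a - i)) *
     (rp a * rp (i - a) * schur_seq (2 * a - i)))); last by ring.
  by rewrite -expfzDr ?expf_neq0 // mulN1r; congr (- (_ ^ _ * _)); ring.
have Zs : asum (fun a => Zterm i (i - a)).
  by apply: eq_asum (asumZ (-1) (asum_Z i)) => a; rewrite ZN.
have : usum (Zterm i) = - usum (Zterm i).
  rewrite {1}(usum_bij (reflK i) (reflK i) Zs) (eq_usum ZN) usumZ ?mulN1r //.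
by move=> /eqP; rewrite eq_sym -subr_eq0 -opprD oppr_eq0 -mulr2n mulrn_eq0 /= => /eqP.
Qed.

Let shiftK : cancel (fun b : int => b - 1) (fun b => b + 1).
Proof. by move=> b; rewrite subrK. Qed.
Let Kshift : cancel (fun b : int => b + 1) (fun b => b - 1).
Proof. by move=> b; rewrite addrK. Qed.

(* Schur's finite form of the pentagonal number theorem. *)
Lemma binomT_schur_seqS i : binomT q (fun r => schur_seq (r + 1)) i = rp i.
Proof.
pose s i := binomT q (fun r => schur_seq (r + 1)) i; rewrite -/(s i).
have srec k : (1 - p ^ k) * s k = s (k - 1).
  pose A a := rp (a - 1) * rp (k - a) * schur_seq (2 * a - k + 1).
  have As1 : asum (fun a => A (a + 1)).
    apply: eq_asum (asum_binomT q0 q1 (k - 1) (bounded_schur_seqD 2)) => a.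
    by rewrite /A addrK; congr (_ * rp _ * schur_seq _); ring.
  have As : asum A by exact: asum_bij shiftK As1.
  (* After the shift, the reflection a -> k - 1 - a combined with the symmetry s -> 3 - s of
     [schur_seq] restores the original form. *)
  have EA : usum A = s (k - 1).
    rewrite (usum_bij Kshift shiftK As1).
    have As2 : asum (fun a => A (k - 1 - a + 1)).
      by apply: asum_comp As1; exact: can_inj (reflK (k - 1)).
    rewrite (usum_bij (reflK (k - 1)) (reflK (k - 1)) As2).
    apply: eq_usum => a; rewrite /A addrK.
    rewrite (_ : 2 * (k - 1 - a + 1) - k + 1 = 3 - (2 * a - (k - 1) + 1)); last by ring.
    rewrite schur_seq_refl (_ : k - (k - 1 - a + 1) = a); last by ring.
    by rewrite [rp (k - 1 - a) * _]mulrC.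
  rewrite -EA /s /binomT -usumZ; last exact: (asum_binomT q0 q1 k (bounded_schur_seqD 1)).
  (* The split is 1 - p^k = (1 - p^a) + p^a (1 - p^(k-a)); the second part sums to zero by
     [usum_Z]. *)
  rewrite -[RHS]addr0 -(usum_Z (k - 1)) -usumD //.
  apply: eq_usum => a; rewrite /A /Zterm rp_pred //.
  rewrite (_ : k - 1 - a = k - a - 1); last by ring.
  rewrite rp_pred // (_ : 2 * a - (k - 1) = 2 * a - k + 1); last by ring.
  have -> : p ^ k = p ^ a * p ^ (k - a) by rewrite -expfzDr ?expf_neq0 //; congr (_ ^ _); ring.
  ring.
have s0 : s 0 = 1.
  rewrite /s /binomT (usum1 (x := 0)).
    have := schur_seq_1 0; rewrite expr0z mul1r !mulr0 subrr expr0z => b1.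
    by rewrite ?subr0 rp0 !mul1r b1.
  move=> a a0; have [a1|a1] : a < 0 \/ 0 - a < 0 by lia.
    by rewrite rp_neg // !mul0r.
  by rewrite [rp (0 - a)]rp_neg // mulr0 mul0r.
case: i => i; last first.
  rewrite /s /binomT usum0 // => a.
  have [a1|a1] : a < 0 \/ Negz i - a < 0 by lia.
    by rewrite rp_neg // !mul0r.
  by rewrite [rp (Negz i - a)]rp_neg // mulr0 mul0r.
elim: i => [|i IH]; first by rewrite s0 rp0.
have nz : 1 - p ^ i.+1%:Z != 0.
  by apply: normr_lt1_subr_neq0; rewrite normrXz -exprnP exprn_ilt1.
have iE : i.+1%:Z - 1 = i by lia.
by apply: (mulfI nz); rewrite srec -rp_pred // iE IH.
Qed.

(** With 1 = (1 - p^a) + p^a, the p^a part vanishes by [usum_Z] and the rest is the shifted sequence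
    at i - 1. Since rp (i - 1) = (1 - p^i) rp i, this is the input f_i = 1 - p^i. *)
Lemma binomT_schur_seq i : binomT q schur_seq i = rp (i - 1).
Proof.
rewrite -binomT_schur_seqS.
pose A a := rp (a - 1) * rp (i - a) * schur_seq (2 * a - i).
have As1 : asum (fun a => A (a + 1)).
  apply: eq_asum (asum_binomT q0 q1 (i - 1) (bounded_schur_seqD 1)) => a.
  by rewrite /A addrK; congr (_ * rp _ * schur_seq _); ring.
have As : asum A by exact: asum_bij shiftK As1.
have -> : binomT q (fun r => schur_seq (r + 1)) (i - 1) = usum A.
  rewrite (usum_bij Kshift shiftK As1); apply: eq_usum => a.
  by rewrite /A addrK; congr (_ * rp _ * schur_seq _); ring.
rewrite -[RHS]addr0 -(usum_Z i) -usumD //; apply: eq_usum => a.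
by rewrite /A /Zterm rp_pred //; ring.
Qed.

Let W (x : int * int * int) : K :=
  q ^ ((x.1.1 - x.1.2) * (x.1.1 - x.1.2) + (x.1.2 - x.2) * (x.1.2 - x.2) + x.2 * x.2) *
  (rp (x.1.1 - 1) * (rp x.1.2 * rp x.2)).

Let asum_W : asum W.
Proof.
have [d [d0 Hd]] := rp_bound p1.
apply: (@asum_exp _ _ (fun x => `|x.1.1| + `|x.1.2| + `|x.2|)%N _ (d * (d * d)) 27%N) => //.
- by apply: asum_geom3 => //; exact: ltW.
- move=> [[i j] k] /= _.
  have t3 := sqr_ge_linear 3.
  apply: le_trans (lerD (lerD (t3 (i - j)) (t3 (j - k))) (t3 k)); lia.
- move=> x; rewrite !normrM; apply: ler_pM; rewrite ?mulr_ge0 //.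
  exact: ler_pM.
Qed.

(** The indices i, j, k are summed in this order, each sum being one use of [binomT_theta] and
    giving one factor [durfee p 0]. The last use has parameter 0, where [binomT] retains only the
    value at 0. *)
Lemma usum_cube_theta :
  usum W = durfee p 0 ^+ 3 * thetaT q (thetaT q (thetaT q schur_seq)) 0.
Proof.
have b1 := bounded_thetaT q0 q1 bounded_schur_seq.
have b2 := bounded_thetaT q0 q1 b1.
have b3 := bounded_thetaT q0 q1 b2.
set d := durfee p 0.
rewrite (usum_swap asum_W).
have E k : usum (fun x : int * int => W (x, k)) =
    d ^+ 2 * (q ^ (k * k) * binomT q (thetaT q (thetaT q schur_seq)) k).
  have Ws := asum_col k asum_W.
  rewrite (usum_swap Ws).
  have Ej (j : int) : usum (fun i => W (i, j, k)) =
     d * q ^ (2 * k * k) * rp k * (q ^ (j * j - 2 * j * k) * binomT q (thetaT q schur_seq) j).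
    have Ei (i : int) : W (i, j, k) = (q ^ (2 * j * j + 2 * k * k - 2 * j * k) * (rp j * rp k)) *
        (q ^ (i * i - 2 * i * j) * binomT q schur_seq i).
      rewrite /W /= binomT_schur_seq.
      have -> : (i - j) * (i - j) + (j - k) * (j - k) + k * k =
        2 * j * j + 2 * k * k - 2 * j * k + (i * i - 2 * i * j) by ring.
      rewrite (@expfzDr _ q _ (i * i - 2 * i * j)) //; ring.
    rewrite (eq_usum Ei) usumZ; last exact/asum_expr_binomT/bounded_schur_seq.
    rewrite [LHS](_ : _ = (q ^ (2 * j * j + 2 * k * k - 2 * j * k) * rp k) *
      (rp j * usum (fun i => q ^ (i * i - 2 * i * j) * binomT q schur_seq i))); last by ring.
    rewrite binomT_theta //; last exact: bounded_schur_seq.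
    have -> : 2 * j * j + 2 * k * k - 2 * j * k = 2 * k * k + (j * j - 2 * j * k) + j * j by ring.
    rewrite (@expfzDr _ q _ (j * j)) // (@expfzDr _ q (2 * k * k)) //.
    have e : q ^ (j * j) * q ^ (- (j * j)) = 1 by rewrite -expfzDr // subrr.
    rewrite [LHS](_ : _ = (q ^ (j * j) * q ^ (- (j * j))) * (d * q ^ (2 * k * k) * rp k *
      (q ^ (j * j - 2 * j * k) * binomT q (thetaT q schur_seq) j))); last by rewrite /d; ring.
    by rewrite e mul1r.
  rewrite (eq_usum Ej) usumZ; last exact: asum_expr_binomT.
  rewrite -mulrA binomT_theta // -/d.
  have -> : 2 * k * k = k * k + k * k by ring.
  rewrite expfzDr //.
  have e : q ^ (k * k) * q ^ (- (k * k)) = 1 by rewrite -expfzDr // subrr.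
  rewrite [LHS](_ : _ = (q ^ (k * k) * q ^ (- (k * k))) * (d ^+ 2 *
    (q ^ (k * k) * binomT q (thetaT q (thetaT q schur_seq)) k))); last by ring.
  by rewrite e mul1r.
rewrite (eq_usum E).
have Es : asum (fun k => q ^ (k * k) * binomT q (thetaT q (thetaT q schur_seq)) k).
  by apply: eq_asum (asum_expr_binomT q0 q1 0 b2) => k; rewrite mulr0 subr0.
rewrite usumZ; last exact: Es.
have := binomT_theta q0 q1 0 b2.
rewrite rp0 mul1r mulr0 oppr0 expr0z mulr1.
rewrite (_ : usum _ =
  usum (fun k => q ^ (k * k) * binomT q (thetaT q (thetaT q schur_seq)) k)); last first.
  by apply: eq_usum => k; rewrite mulr0 subr0.
move=> ->; rewrite /binomT (usum1 (x := 0)).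
  by rewrite subrr rp0 !mul1r -/d mulrA -exprSr.
move=> a a0; have [a1|a1] : a < 0 \/ 0 - a < 0 by lia.
  by rewrite rp_neg // !mul0r.
by rewrite [rp (0 - a)]rp_neg // mulr0 mul0r.
Qed.

End SchurSequence.

(** * Theta series *)

Section Splitting.
Context {R : realType}.
Local Notation K := R[i].
Implicit Types (I J : choiceType).

Lemma usum_split3 I J (h0 h1 h2 : J -> I) (k : I -> int) (f : I -> K) :
  injective h0 -> injective h1 -> injective h2 ->
  (forall y, k (h0 y) = 0) -> (forall y, k (h1 y) = 1) -> (forall y, k (h2 y) = 2) ->
  (forall x, exists y, [\/ x = h0 y, x = h1 y | x = h2 y]) -> asum f ->
  usum f = usum (fun y => f (h0 y)) + usum (fun y => f (h1 y)) + usum (fun y => f (h2 y)).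
Proof.
move=> i0 i1 i2 k0 k1 k2 hx fs.
pose g (e : int) x := (k x == e)%:R * f x.
have gs e : asum (g e).
  apply: asum_le fs => [|a]; first exact: ler01.
  by rewrite normrM ler_wpM2r // normr_nat lern1 leq_b1.
have ghE (h : J -> I) e : injective h -> (forall y, k (h y) = e) ->
    (forall x, k x = e -> exists y, x = h y) ->
    usum (g e) = usum (fun y => f (h y)).
  move=> ih kh eh; rewrite (usum_reindex ih) //.
    by apply: eq_usum => y; rewrite /g kh eqxx mul1r.
  move=> x; rewrite /g; case: (k x =P e) => [kx _|_]; first exact: eh.
  by rewrite mul0r eqxx.
rewrite -(ghE h0 0) // => [|x kx]; last first.
  by have [y [|E|E]] := hx x; [exists y | move: kx; rewrite E k1 | move: kx; rewrite E k2].
rewrite -(ghE h1 1) // => [|x kx]; last first.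
  by have [y [E||E]] := hx x; [move: kx; rewrite E k0 | exists y | move: kx; rewrite E k2].
rewrite -(ghE h2 2) // => [|x kx]; last first.
  by have [y [E|E|]] := hx x; [move: kx; rewrite E k0 | move: kx; rewrite E k1 | exists y].
rewrite -usumD // -usumD //; last exact: asumD.
apply: eq_usum => x; rewrite /g.
by have [y [->|->|->]] := hx x; rewrite ?k0 ?k1 ?k2 /= !mul0r !mul1r ?addr0 ?add0r.
Qed.

Lemma usum_mod3 (f : int -> K) : asum f ->
  usum f = usum (fun n => f (3 * n)) + usum (fun n => f (3 * n + 1)) +
           usum (fun n => f (3 * n + 2)).
Proof.
apply: (usum_split3 (k := fun s => (s %% 3)%Z)).
- by move=> x y /= /mulfI; apply.
- by move=> x y /= /addIr /mulfI; apply.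
- by move=> x y /= /addIr /mulfI; apply.
- by move=> y; rewrite mulrC modzMl.
- by move=> y; rewrite mulrC modzMDl.
- by move=> y; rewrite mulrC modzMDl.
- exact: int_mod3.
Qed.

End Splitting.

Section ThetaEvaluation.
Context {R : realType}.
Local Notation K := R[i].
Variables (q : K) (q0 : 0 < `|q|) (q1 : `|q| < 1).

Let qn0 : q != 0. Proof. by rewrite -normr_gt0. Qed.

(* The sum of q^(x^2+y^2+t^2) over x + y + t = [u], with [x.1] = - y. *)
Definition hexsum (u : int) : K := usum (fun x : int * int =>
  q ^ ((u + x.1 - x.2) * (u + x.1 - x.2) + x.1 * x.1 + x.2 * x.2)).

Lemma asum_exp1 (I : choiceType) (w : I -> nat) (c : nat) (e : I -> int) :
  asum (fun x => `|q| ^+ w x) -> (forall x, (w x)%:Z - c%:Z <= e x) ->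
  asum (fun x => q ^ e x).
Proof.
move=> ws we.
have := @asum_exp _ _ w q 1 c e (fun=> 1) q0 q1 ws (fun x _ => we x).
move=> H; apply: eq_asum (H _) => x; first by rewrite mulr1.
by rewrite normr1.
Qed.

Lemma asum_hexsum u : asum (fun x : int * int =>
  q ^ ((u + x.1 - x.2) * (u + x.1 - x.2) + x.1 * x.1 + x.2 * x.2)).
Proof.
apply: (@asum_exp1 _ (fun x => `|x.1| + `|x.2|)%N 0).
  by apply: asum_geom2 => //; exact: ltW.
move=> [y t] /=.
have tt := absz_le_sqr.
have := tt y; have := tt t; have := sqr_ge0 (u + y - t); rewrite expr2.
by move: (_ * _) => a; lia.
Qed.

(** Translation by n (1, 1, 1) maps the plane x + y + t = u to that with sum u + 3n and adds 3n^2 +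
    2un to the quadratic form; the sign convention on y explains the opposite shifts in [h]. *)
Lemma hexsum_shift u n : hexsum (u + 3 * n) = q ^ (3 * n * n + 2 * u * n) * hexsum u.
Proof.
pose h (x : int * int) := (x.1 - n, x.2 + n).
pose h' (x : int * int) := (x.1 + n, x.2 - n).
have hK : cancel h h' by move=> [a b]; rewrite /h /h' /=; congr (_, _); ring.
have h'K : cancel h' h by move=> [a b]; rewrite /h /h' /=; congr (_, _); ring.
rewrite /hexsum (usum_bij hK h'K); last first.
  exact: asum_comp (can_inj hK) (asum_hexsum _).
rewrite -usumZ; last exact: asum_hexsum.
apply: eq_usum => -[y t] /=; rewrite -expfzDr //; congr (_ ^ _); ring.
Qed.

Lemma hexsumN u : hexsum (- u) = hexsum u.
Proof.
pose h (x : int * int) := (- x.1, - x.2).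
have hK : cancel h h by move=> [a b]; rewrite /h /= !opprK.
rewrite /hexsum (usum_bij hK hK); last first.
  exact: asum_comp (can_inj hK) (asum_hexsum _).
by apply: eq_usum => -[y t] /=; congr (_ ^ _); ring.
Qed.

(** The three convolutions form a sum over integer triples, which is regrouped by the argument u of
    [B]. *)
Lemma cube_theta_hexsum (B : int -> K) : bounded B ->
  thetaT q (thetaT q (thetaT q B)) 0 = usum (fun u => B u * hexsum u).
Proof.
move=> Bb; have [d Bd] := Bb.
have b1 := bounded_thetaT q0 q1 Bb; have b2 := bounded_thetaT q0 q1 b1.
pose F (x : int * int * int) : K :=
  q ^ (x.1.1 * x.1.1 + x.1.2 * x.1.2 + x.2 * x.2) * B (x.2 - x.1.2 + x.1.1).
have tt := absz_le_sqr.
have Fs : asum F.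
  apply: (@asum_exp _ _ (fun x => `|x.1.1| + `|x.1.2| + `|x.2|)%N _ d 0%N) => //.
  - by apply: asum_geom3 => //; exact: ltW.
  - move=> [[i j] k] /= _; have := tt i; have := tt j; have := tt k; lia.
have -> : thetaT q (thetaT q (thetaT q B)) 0 = usum F.
  rewrite usum_fubini // usum_fubini; last exact: asum_usum.
  have tE C w : thetaT q C w = usum (fun x => q ^ (x * x) * C (x - w)) by [].
  apply: eq_usum => t; rewrite tE -usumZ; last exact: asum_thetaT.
  apply: eq_usum => y; rewrite tE -!usumZ; last exact: asum_thetaT.
    2: by apply: asumZ; exact: asum_thetaT.
  apply: eq_usum => x; rewrite /F /= !expfzDr // !mulrA; congr (_ * B _); ring.
pose h (x : int * (int * int)) := ((x.2.2, x.2.1), x.1 + x.2.1 - x.2.2).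
pose h' (x : int * int * int) := (x.2 - x.1.2 + x.1.1, (x.1.2, x.1.1)).
have hK : cancel h h' by move=> [u [y t]]; rewrite /h /h' /=; congr (_, _); ring.
have h'K : cancel h' h by move=> [[t y] x]; rewrite /h /h' /=; congr (_, _); ring.
have Fhs : asum (fun x => F (h x)) by apply: asum_comp Fs; exact: can_inj hK.
rewrite (usum_bij hK h'K Fhs) usum_fubini //; apply: eq_usum => u.
rewrite /hexsum -usumZ; last exact: asum_hexsum.
apply: eq_usum => -[y t]; rewrite /F /h /= mulrC; congr (B _ * _ ^ _); ring.
Qed.

Definition sgn_sq0 : K := usum (fun n : int => (-1) ^ n * q ^ (9 * n * n)).
Definition sgn_sq1 : K := usum (fun n : int => (-1) ^ n * q ^ ((3 * n + 1) * (3 * n + 1))).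

Lemma asum_sign (f : int -> K) : asum f -> asum (fun n : int => (-1) ^ n * f n).
Proof.
apply: asum_le => [|n]; first exact: ler01.
by rewrite normrM normr_signz mul1r.
Qed.

Lemma asum_sq0 : asum (fun n : int => q ^ (9 * n * n)).
Proof.
apply: (@asum_exp1 _ (fun x => `|x|)%N 0); first by apply: asum_geom => //; exact: ltW.
by move=> n; nia.
Qed.

Lemma asum_sq1 : asum (fun n : int => q ^ ((3 * n + 1) * (3 * n + 1))).
Proof.
apply: (@asum_exp1 _ (fun x => `|x|)%N 0); first by apply: asum_geom => //; exact: ltW.
by move=> n; nia.
Qed.

(** Modulo 3, the class 0 of u drops out, and the classes 1 and 2 reduce to [hexsum 1] and give
    [sgn_sq0] and [sgn_sq1] respectively. *)
Lemma cube_theta_schur_seq : thetaT q (thetaT q (thetaT q (schur_seq q))) 0 =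
  hexsum 1 * (sgn_sq0 + sgn_sq1).
Proof.
rewrite cube_theta_hexsum; last exact: bounded_schur_seq.
have bs : asum (fun u => schur_seq q u * hexsum u).
  pose F (x : int * (int * int)) : K := q ^ ((x.1 + x.2.1 - x.2.2) * (x.1 + x.2.1 - x.2.2)
     + x.2.1 * x.2.1 + x.2.2 * x.2.2) * schur_seq q x.1.
  have Fs : asum F.
    apply: (@asum_exp _ _ (fun x => `|x.1| + (`|x.2.1| + `|x.2.2|))%N _ 1 27%N) => //.
    - apply: eq_asum (asum_prod (asum_geom (ltW q0) q1) (asum_geom2 (ltW q0) q1)) => x.
      by rewrite [RHS]exprD.
    - have t3 := sqr_ge_linear 3.
      move=> [u [y t]] /= _.
      by apply: le_trans (lerD (lerD (t3 (u + y - t)) (t3 y)) (t3 t)); lia.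
    - by move=> x; exact: schur_seq_bound.
  apply: eq_asum (asum_usum Fs) => u.
  rewrite /F /hexsum -usumZ; last exact: asum_hexsum.
  by apply: eq_usum => x /=; rewrite mulrC.
rewrite (usum_mod3 bs) (usum0 (f := fun n => _ (3 * n) * _)) => [|n]; last first.
  by rewrite schur_seq_0 mul0r.
rewrite add0r mulrDr /sgn_sq0 /sgn_sq1 -!usumZ; first last.
- exact/asum_sign/asum_sq0.
- exact/asum_sign/asum_sq1.
congr (_ + _); apply: eq_usum => n.
  rewrite schur_seq_1 [3 * n + 1]addrC hexsum_shift.
  have -> : 9 * n * n = (6 * n * n - 2 * n) + (3 * n * n + 2 * 1 * n) by ring.
  rewrite (@expfzDr _ q (6 * n * n - 2 * n)) //; ring.
(* Representing the class 2 by -1 allows the use of [hexsumN]; the shift n + 1 then completes the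
   square (3n + 1)^2. *)
have -> : hexsum (3 * n + 2) = hexsum (-1 + 3 * (n + 1)) by congr hexsum; ring.
rewrite hexsum_shift hexsumN schur_seq_2.
have -> : (3 * n + 1) * (3 * n + 1) =
  (6 * n * n + 2 * n) + (3 * (n + 1) * (n + 1) + 2 * -1 * (n + 1)) by ring.
rewrite (@expfzDr _ q (6 * n * n + 2 * n)) //; ring.
Qed.

End ThetaEvaluation.

(** * Infinite products and the pentagonal number theorem *)

Section Products.
Context {R : realType}.
Local Notation K := R[i].
Variables (s : K) (s0 : 0 < `|s|) (s1 : `|s| < 1).

Let sn0 : s != 0. Proof. by rewrite -normr_gt0. Qed.
Let s30 : 0 < `|s ^+ 3|. Proof. by rewrite normrX exprn_gt0. Qed.
Let s31 : `|s ^+ 3| < 1. Proof. by rewrite normrX exprn_ilt1. Qed.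

Lemma qpoch_inf_mul3 (a : K) : a != 0 ->
  qpoch_inf a (s ^+ 2) = qpoch_inf a (s ^+ 6) * qpoch_inf (a * s ^+ 2) (s ^+ 6) *
    qpoch_inf (a * s ^+ 4) (s ^+ 6).
Proof.
move=> a0; have -> : s ^+ 6 = (s ^+ 3) ^+ 2 by rewrite -exprM.
have H (n : nat) : qpoch a (s ^+ 2) (3 * n) = qpoch a ((s ^+ 3) ^+ 2) n *
    qpoch (a * s ^+ 2) ((s ^+ 3) ^+ 2) n * qpoch (a * s ^+ 4) ((s ^+ 3) ^+ 2) n.
  elim: n => [|n IH]; first by rewrite muln0 /qpoch !big_ord0 !mulr1.
  rewrite (_ : (3 * n.+1 = (3 * n).+3)%N); last lia.
  rewrite !qpochS IH -!exprM.
  have -> : s ^+ (2 * (3 * n)) = s ^+ (3 * 2 * n) by congr (_ ^+ _); lia.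
  have -> : s ^+ (2 * (3 * n).+1) = s ^+ 2 * s ^+ (3 * 2 * n).
    by rewrite -exprD; congr (_ ^+ _); lia.
  have -> : s ^+ (2 * (3 * n).+2) = s ^+ 4 * s ^+ (3 * 2 * n).
    by rewrite -exprD; congr (_ ^+ _); lia.
  by ring.
have as2 : a * s ^+ 2 != 0 by rewrite mulf_neq0 // expf_neq0.
have as4 : a * s ^+ 4 != 0 by rewrite mulf_neq0 // expf_neq0.
rewrite (qpoch_infE s0 s1 a0) !(qpoch_infE s30 s31) //.
have h3 n : (n <= 3 * n)%N by exact: leq_pmull.
apply: seqlim_uniq (seqlim_sub h3 (seqlim_qpoch s0 s1 a0)) _.
have := seqlimM (seqlimM (seqlim_qpoch s30 s31 a0) (seqlim_qpoch s30 s31 as2))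
  (seqlim_qpoch s30 s31 as4).
by congr seqlim; apply/funext => n; rewrite H.
Qed.

(** From (-x; x)_oo (x; x)_oo = (x^2; x^2)_oo with x = s^2, whose right side is nonzero. *)
Lemma qpoch_infN_neq0 : qpoch_inf (- s ^+ 2) (s ^+ 2) != 0.
Proof.
have s20 : 0 < `|s ^+ 2| by rewrite normrX exprn_gt0.
have s21 : `|s ^+ 2| < 1 by rewrite normrX exprn_ilt1.
have a0 : - s ^+ 2 != 0 by rewrite oppr_eq0 expf_neq0.
have b0 : s ^+ 2 != 0 by rewrite expf_neq0.
have c0 : (s ^+ 2) ^+ 2 != 0 by rewrite !expf_neq0.
have H n : qpoch (- s ^+ 2) (s ^+ 2) n * qpoch (s ^+ 2) (s ^+ 2) n =
    qpoch ((s ^+ 2) ^+ 2) ((s ^+ 2) ^+ 2) n.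
  rewrite /qpoch -big_split /=; apply: eq_bigr => k _.
  rewrite (exprAC (s ^+ 2) 2 k).
  by ring.
have : qpoch_inf (- s ^+ 2) (s ^+ 2) * qpoch_inf (s ^+ 2) (s ^+ 2) =
    qpoch_inf ((s ^+ 2) ^+ 2) ((s ^+ 2) ^+ 2).
  rewrite !(qpoch_infE s0 s1) // (qpoch_infE s20 s21) //.
  apply: seqlim_uniq (seqlimM (seqlim_qpoch s0 s1 a0) (seqlim_qpoch s0 s1 b0)) _.
  by have := seqlim_qpoch s20 s21 c0; congr seqlim; apply/funext => n; rewrite H.
move=> E; apply/eqP => h; have := qpoch_inf_neq0 s20 s21.
by rewrite -E h mul0r eqxx.
Qed.

(** The triple product with base s^6 and z = s^4; its three factors are the residue classes modulo 3
    of (s^2; s^2)_oo. *)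
Lemma pentagonal : qpoch_inf (s ^+ 2) (s ^+ 2) =
  usum (fun n : int => (-1) ^ n * s ^ (3 * n * n + n)).
Proof.
have z0 : s ^+ 4 != 0 by rewrite expf_neq0.
have [e4 e6] : s ^+ 2 * s ^+ 2 = s ^+ 4 /\ s ^+ 2 * s ^+ 4 = s ^+ 6 by rewrite -!exprD.
have e2 : s ^+ 6 / s ^+ 4 = s ^+ 2 by rewrite -e6 mulfK.
have := jacobi_triple s30 s31 z0; rewrite -exprM -[(3 * 2)%N]/6%N e2 => H.
have s2 : s ^+ 2 != 0 by rewrite expf_neq0.
have := qpoch_inf_mul3 s2; rewrite e4 e6 => ->; rewrite [X in X * _]mulrC -H.
apply: eq_usum => n; have -> : - s ^+ 4 = -1 * s ^+ 4 by rewrite mulN1r.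
rewrite [(-1 * s ^+ 4) ^ n]expfzMl mulrCA !exprnP !exprz_exp -expfzDr //.
by congr (_ * _ ^ _); ring.
Qed.

End Products.

(** * The hexagonal theta series as a product *)

Section CubicTheta.
Context {R : realType}.
Local Notation K := R[i].
Variables (q : K) (q0 : 0 < `|q|) (q1 : `|q| < 1).

Let qn0 : q != 0. Proof. by rewrite -normr_gt0. Qed.

Let expo (n b c : int) := 3 * (n - b - c) * (n - b - c - 1) + (3 * b * (b - 1) + 2 * b) +
  (3 * c * (c - 1) + 4 * c).

(** The part a + b + c = n of a product of three theta series with base q^6, namely those at z = -1,
    -q^2 and -q^4 in the triple product. *)
Let csum (n : int) : K := usum (fun x : int * int => q ^ (expo n x.1 x.2)).

Let F (x : int * (int * int)) : K := q ^ (3 * x.1 * (x.1 - 1)) *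
  (q ^ (3 * x.2.1 * (x.2.1 - 1) + 2 * x.2.1) * q ^ (3 * x.2.2 * (x.2.2 - 1) + 4 * x.2.2)).

Let asum_a : asum (fun a : int => q ^ (3 * a * (a - 1))).
Proof.
apply: (@asum_exp1 _ _ q0 q1 _ (fun x => `|x|)%N 3).
  by apply: asum_geom => //; exact: ltW.
by move=> n; nia.
Qed.

Let asum_b : asum (fun b : int => q ^ (3 * b * (b - 1) + 2 * b)).
Proof.
apply: (@asum_exp1 _ _ q0 q1 _ (fun x => `|x|)%N 3).
  by apply: asum_geom => //; exact: ltW.
by move=> n; nia.
Qed.

Let asum_c : asum (fun c : int => q ^ (3 * c * (c - 1) + 4 * c)).
Proof.
apply: (@asum_exp1 _ _ q0 q1 _ (fun x => `|x|)%N 3).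
  by apply: asum_geom => //; exact: ltW.
by move=> n; nia.
Qed.

Let asum_F : asum F.
Proof. exact: asum_prod asum_a (asum_prod asum_b asum_c). Qed.

Let hF (x : int * (int * int)) := (x.1 - x.2.1 - x.2.2, x.2).
Let hF' (x : int * (int * int)) := (x.1 + x.2.1 + x.2.2, x.2).
Let hFK : cancel hF hF'.
Proof. by move=> [a [b c]]; rewrite /hF /hF' /=; congr (_, _); ring. Qed.
Let hF'K : cancel hF' hF.
Proof. by move=> [a [b c]]; rewrite /hF /hF' /=; congr (_, _); ring. Qed.

Let FE n b c : F (hF (n, (b, c))) = q ^ (expo n b c).
Proof. by rewrite /F /hF /expo /= -!expfzDr //; congr (_ ^ _); ring. Qed.

Let asum_csum n : asum (fun x : int * int => q ^ (expo n x.1 x.2)).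
Proof.
have Fhs : asum (fun x => F (hF x)) by apply: asum_comp asum_F; exact: can_inj hFK.
by apply: eq_asum (asum_row n Fhs) => -[b c]; rewrite FE.
Qed.

(** The cyclic substitution (b, c) -> (n - b - c, b) changes [expo (n + 1)] into [expo n] plus 2(a +
    b + c) = 2n. *)
Let csumS n : csum (n + 1) = q ^ (2 * n) * csum n.
Proof.
pose h (x : int * int) := (n - x.1 - x.2, x.1).
pose h' (x : int * int) := (x.2, n - x.1 - x.2).
have hK : cancel h h' by move=> [b c]; rewrite /h /h' /=; congr (_, _); ring.
have h'K : cancel h' h by move=> [b c]; rewrite /h /h' /=; congr (_, _); ring.
rewrite /csum (usum_bij hK h'K); last first.
  exact: asum_comp (can_inj hK) (asum_csum _).
rewrite -usumZ //; apply: eq_usum => -[b c] /=; rewrite -expfzDr //.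
by congr (_ ^ _); rewrite /expo; ring.
Qed.

Let csumE n : csum n = q ^ (n * (n - 1)) * csum 0.
Proof.
pose f m := q ^ (- (m * (m - 1))) * csum m.
have fS m : f (m + 1) = f m.
  by rewrite /f csumS mulrA -expfzDr //; congr (_ ^ _ * _); ring.
have := int_shift_cst fS n; rewrite /f !mul0r oppr0 expr0z mul1r => <-.
by rewrite mulrA -expfzDr // subrr expr0z mul1r.
Qed.

Let cprod : usum (fun a : int => q ^ (3 * a * (a - 1))) *
  (usum (fun b : int => q ^ (3 * b * (b - 1) + 2 * b)) *
   usum (fun c : int => q ^ (3 * c * (c - 1) + 4 * c))) =
  csum 0 * usum (fun n : int => q ^ (n * (n - 1))).
Proof.
have Fhs : asum (fun x => F (hF x)) by apply: asum_comp asum_F; exact: can_inj hFK.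
rewrite (usumM asum_b asum_c) (usumM asum_a (asum_prod asum_b asum_c)).
rewrite -/F (usum_bij hFK hF'K Fhs) usum_fubini //.
rewrite -usumZ; last first.
  apply: (@asum_exp1 _ _ q0 q1 _ (fun x => `|x|)%N 1).
    by apply: asum_geom => //; exact: ltW.
  by move=> n; nia.
apply: eq_usum => n; rewrite mulrC -csumE.
by apply: eq_usum => -[b c]; rewrite FE.
Qed.

(** All four series in [cprod] are evaluated by the triple product. Both sides then contain (-1;
    q^2)_oo (-q^2; q^2)_oo, which on the left is assembled from products with base q^6. *)
Let csum0 : csum 0 * J 2 q = J 6 q ^+ 3.
Proof.
have q30 : 0 < `|q ^+ 3| by rewrite normrX exprn_gt0.
have q31 : `|q ^+ 3| < 1 by rewrite normrX exprn_ilt1.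
have n1 : (-1 : K) != 0 by rewrite oppr_eq0 oner_eq0.
have n2 : - q ^+ 2 != 0 by rewrite oppr_eq0 expf_neq0.
have n4 : - q ^+ 4 != 0 by rewrite oppr_eq0 expf_neq0.
have q6 : (q ^+ 3) ^+ 2 = q ^+ 6 by rewrite -exprM.
have i1 : (-1 : K)^-1 = -1 by rewrite invrN1.
have H1 := jacobi_triple q30 q31 n1; have H2 := jacobi_triple q30 q31 n2.
have H4 := jacobi_triple q30 q31 n4; have H := jacobi_triple q0 q1 n1.
have e1 : q ^+ 6 / -1 = - q ^+ 6 by rewrite i1 mulrN1.
have e2 : q ^+ 6 / - q ^+ 2 = - q ^+ 4.
  by rewrite invrN mulrN (_ : 6 = 4 + 2)%N // exprD mulfK // expf_neq0.
have e4 : q ^+ 6 / - q ^+ 4 = - q ^+ 2.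
  by rewrite invrN mulrN (_ : 6 = 2 + 4)%N // exprD mulfK // expf_neq0.
have e0 : q ^+ 2 / -1 = - q ^+ 2 by rewrite i1 mulrN1.
rewrite q6 e1 in H1; rewrite q6 e2 in H2; rewrite q6 e4 in H4; rewrite e0 in H.
have E := cprod.
have E1 : usum (fun a : int => q ^ (3 * a * (a - 1))) =
    usum (fun m : int => (q ^+ 3) ^ (m * (m - 1)) * (- -1) ^ m).
  by apply: eq_usum => m; rewrite opprK exp1rz mulr1 exprnP exprz_exp mulrA.
have E2 : usum (fun b : int => q ^ (3 * b * (b - 1) + 2 * b)) =
    usum (fun m : int => (q ^+ 3) ^ (m * (m - 1)) * (- - q ^+ 2) ^ m).
  by apply: eq_usum => m; rewrite opprK !exprnP !exprz_exp -expfzDr // mulrA.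
have E4 : usum (fun c : int => q ^ (3 * c * (c - 1) + 4 * c)) =
    usum (fun m : int => (q ^+ 3) ^ (m * (m - 1)) * (- - q ^+ 4) ^ m).
  by apply: eq_usum => m; rewrite opprK !exprnP !exprz_exp -expfzDr // mulrA.
have E0 : usum (fun n : int => q ^ (n * (n - 1))) =
    usum (fun m : int => q ^ (m * (m - 1)) * (- -1) ^ m).
  by apply: eq_usum => m; rewrite opprK exp1rz mulr1.
rewrite E1 H1 E2 H2 E4 H4 E0 H in E.
have P1 := qpoch_inf_mul3 q0 q1 n1; have P2 := qpoch_inf_mul3 q0 q1 n2.
rewrite !mulN1r in P1; rewrite !mulNr -!exprD /= in P2.
(* The common factors must be nonzero to cancel; the first factor 1 - (-1) = 2 reduces (-1; q^2)_oo
   to (-q^2; q^2)_oo. *)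
have nz2 : qpoch_inf (- q ^+ 2) (q ^+ 2) != 0 by exact: qpoch_infN_neq0.
have nz1 : qpoch_inf (-1) (q ^+ 2) != 0.
  rewrite (qpoch_infE q0 q1) // euler_rec // mulN1r -(qpoch_infE q0 q1) //.
  by rewrite mulf_neq0 // opprK pnatr_eq0.
apply: (mulfI nz1); apply: (mulfI nz2); rewrite /J.
move: E P1 P2; clear.
move: (csum 0) (qpoch_inf (-1) (q ^+ 2)) (qpoch_inf (- q ^+ 2) (q ^+ 2))
  (qpoch_inf (q ^+ 2) (q ^+ 2)) (qpoch_inf (q ^+ 6) (q ^+ 6))
  (qpoch_inf (-1) (q ^+ 6)) (qpoch_inf (- q ^+ 2) (q ^+ 6))
  (qpoch_inf (- q ^+ 4) (q ^+ 6)) (qpoch_inf (- q ^+ 6) (q ^+ 6)).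
move=> c x y j2 j6 a1 a2 a4 a6 E P1 P2.
have -> : y * (x * (c * j2)) = c * (x * y * j2) by ring.
by rewrite -E P1 P2; ring.
Qed.

(* The lattice is cut into three cosets of a sublattice of index 3, permuted by
   the cyclic symmetry of the quadratic form. *)
Lemma hexsum_product : hexsum q 1 * J 2 q = 3 * q * J 6 q ^+ 3.
Proof.
(* Each map parametrizes one class of 1 + 2y - t modulo 3, and is chosen so that the exponent of
   [hexsum] becomes 1 + [expo 0 b c]; this produces the factor 3q. *)
pose h0 (x : int * int) := (x.2 - x.1, 1 + x.1 + 2 * x.2).
pose h1 (x : int * int) := (2 * x.1 + x.2, x.1 - x.2).
pose h2 (x : int * int) := (- x.1 - 2 * x.2 - 1, - 2 * x.1 - x.2).
pose k (x : int * int) : int := ((1 + 2 * x.1 - x.2) %% 3)%Z.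
have k0 y : k (h0 y) = 0.
  by case: y => b c; rewrite /k /h0 /= (_ : _ - _ = (- b) * 3) ?modzMl //; ring.
have k1 y : k (h1 y) = 1.
  by case: y => b c; rewrite /k /h1 /= (_ : _ - _ = (b + c) * 3 + 1) ?modzMDl //; ring.
have k2 y : k (h2 y) = 2.
  by case: y => b c; rewrite /k /h2 /= (_ : _ - _ = (- c - 1) * 3 + 2) ?modzMDl //; ring.
have i0 : injective h0 by move=> [b c] [b' c'] [] e1 e2; congr (_, _); lia.
have i1 : injective h1 by move=> [b c] [b' c'] [] e1 e2; congr (_, _); lia.
have i2 : injective h2 by move=> [b c] [b' c'] [] e1 e2; congr (_, _); lia.
have hx x : exists y, [\/ x = h0 y, x = h1 y | x = h2 y].
  case: x => y t; have [m [E|E|E]] := int_mod3 (1 + 2 * y - t).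
  - by exists (- m, y - m); constructor 1; rewrite /h0 /=; congr (_, _); lia.
  - by exists (y - m, 2 * m - y); constructor 2; rewrite /h1 /=; congr (_, _); lia.
  - by exists (2 * m + 1 - y, - m - 1); constructor 3; rewrite /h2 /=; congr (_, _); lia.
have hE : hexsum q 1 = 3 * (q * csum 0).
  rewrite /hexsum (usum_split3 i0 i1 i2 k0 k1 k2 hx (asum_hexsum q0 q1 1)).
  have Z : q * csum 0 = usum (fun x : int * int => q * q ^ (expo 0 x.1 x.2)).
    by rewrite usumZ.
  have qE (e e' : int) : e = e' + 1 -> q ^ e = q * q ^ e'.
    by move=> ->; rewrite expfzDr // expr1z mulrC.
  transitivity (q * csum 0 + q * csum 0 + q * csum 0); last by ring.
  by congr (_ + _ + _); rewrite Z; apply: eq_usum => -[b c]; apply: qE;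
    rewrite /h0 /h1 /h2 /expo /=; ring.
by rewrite hE -mulrA -mulrA csum0 mulrA.
Qed.

End CubicTheta.

(** * Parity in q and the odd part of the theta product *)

Section OddPart.
Context {R : realType}.
Local Notation K := R[i].

Lemma signz_cases (n : int) : (-1 : K) ^ n = 1 \/ (-1 : K) ^ n = -1.
Proof.
have H (m : nat) : (-1 : K) ^+ m = 1 \/ (-1 : K) ^+ m = -1.
  by rewrite -signr_odd; case: (odd m); [right; rewrite expr1 | left].
by case: n => n; [exact: H | rewrite NegzE signzN; exact: H].
Qed.

Lemma signz_sq (n : int) : (-1 : K) ^ (n * n) = (-1) ^ n.
Proof.
rewrite -exprz_exp; have [E|E] := signz_cases n; first by rewrite E exp1rz.
by rewrite E E.
Qed.

Lemma signz_double (n : int) : (-1 : K) ^ (2 * n) = 1.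
Proof.
rewrite mulrC -exprz_exp; have [->|->] := signz_cases n; first by rewrite exp1rz.
by rewrite -exprnP sqrrN expr1n.
Qed.

Lemma signz_mul3 (n : int) : (-1 : K) ^ (3 * n) = (-1) ^ n.
Proof.
rewrite (_ : 3 * n = 2 * n + n); last by ring.
by rewrite expfzDr ?oppr_eq0 ?oner_eq0 // signz_double mul1r.
Qed.

Lemma exprzN (q : K) (e : int) : (- q) ^ e = (-1) ^ e * q ^ e.
Proof. by rewrite -expfzMl mulN1r. Qed.

Variables (q : K) (q0 : 0 < `|q|) (q1 : `|q| < 1).

Let qn0 : q != 0. Proof. by rewrite -normr_gt0. Qed.

Definition sum_sq0 (q : K) : K := usum (fun n : int => q ^ (9 * n * n)).
Definition sum_sq1 (q : K) : K := usum (fun n : int => q ^ ((3 * n + 1) * (3 * n + 1))).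

Lemma sum_sq0N (x : K) : sum_sq0 (- x) = sgn_sq0 x.
Proof.
apply: eq_usum => n; rewrite exprzN (_ : 9 * n * n = (3 * n) * (3 * n)); last by ring.
by rewrite signz_sq signz_mul3.
Qed.

Lemma signz_mul3S (n : int) : (-1 : K) ^ (3 * n + 1) = - (-1) ^ n.
Proof. by rewrite signzS signz_mul3. Qed.

Lemma sum_sq1N (x : K) : 0 < `|x| -> `|x| < 1 -> sum_sq1 (- x) = - sgn_sq1 x.
Proof.
move=> x0 x1; rewrite -[RHS]mulN1r /sgn_sq1 -usumZ; last exact/asum_sign/asum_sq1.
apply: eq_usum => n; rewrite exprzN signz_sq signz_mul3S; ring.
Qed.

Lemma phi_mod3 (x : K) : 0 < `|x| -> `|x| < 1 -> phi x = sum_sq0 x + 2 * sum_sq1 x.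
Proof.
move=> x0 x1.
have fs : asum (fun n : int => x ^ (n ^+ 2)).
  apply: (@asum_exp1 _ _ x0 x1 _ (fun x => `|x|)%N 0).
    by apply: asum_geom => //; exact: ltW.
  by move=> n; rewrite expr2; nia.
rewrite /phi (usum_mod3 fs) -addrA; congr (_ + _).
  by apply: eq_usum => n; congr (_ ^ _); ring.
rewrite [RHS](_ : _ = sum_sq1 x + sum_sq1 x); last by ring.
congr (_ + _).
have K1 : cancel (fun n : int => - n - 1) (fun n => - n - 1) by move=> n; ring.
rewrite /sum_sq1 (usum_bij K1 K1); last first.
  by apply: eq_asum (asum_sq1 x0 x1) => n; congr (_ ^ _); ring.
by apply: eq_usum => n; congr (_ ^ _); ring.
Qed.

(** The two products combine into a double sum over k and n with weight (-1)^k + (-1)^n. With k = a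
    + b and n = a - b the exponent is 1 + (18a^2 + 6a) + (18b^2 + 6b), so the sum separates into two
    pentagonal series. *)
Lemma odd_product : sum_sq0 q * sgn_sq1 q + sgn_sq0 q * sum_sq1 q = 2 * q * J 12 q ^+ 2.
Proof.
have A1 := asum_sq0 q0 q1; have A2 := asum_sq1 q0 q1.
have A3 := asum_sign A1; have A4 := asum_sign A2.
have q60 : 0 < `|q ^+ 6| by rewrite normrX exprn_gt0.
have q61 : `|q ^+ 6| < 1 by rewrite normrX exprn_ilt1.
have P : J 12 q = usum (fun n : int => (-1) ^ n * q ^ (18 * n * n + 6 * n)).
  have := pentagonal q60 q61; rewrite -exprM /J => ->.
  by apply: eq_usum => n; rewrite exprnP exprz_exp; congr (_ * _ ^ _); ring.
have Ps : asum (fun n : int => (-1) ^ n * q ^ (18 * n * n + 6 * n)).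
  apply: asum_sign; apply: (@asum_exp1 _ _ q0 q1 _ (fun x => `|x|)%N 0).
    by apply: asum_geom => //; exact: ltW.
  by move=> n; nia.
pose F (x : int * int) : K := ((-1) ^ x.1 + (-1) ^ x.2) *
  q ^ ((3 * x.1 + 1) * (3 * x.1 + 1) + 9 * x.2 * x.2).
have B1 := asum_prod A4 A1; have B2 := asum_prod A2 A3.
have FE x : F x = (-1) ^ x.1 * q ^ ((3 * x.1 + 1) * (3 * x.1 + 1)) * q ^ (9 * x.2 * x.2) +
    q ^ ((3 * x.1 + 1) * (3 * x.1 + 1)) * ((-1) ^ x.2 * q ^ (9 * x.2 * x.2)).
  rewrite /F expfzDr //; ring.
have Fs : asum F by apply: eq_asum (asumD B1 B2) => x; rewrite FE.
have -> : sum_sq0 q * sgn_sq1 q + sgn_sq0 q * sum_sq1 q = usum F.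
  rewrite (eq_usum FE) (usumD B1 B2) -(usumM A4 A1) -(usumM A2 A3).
  by rewrite mulrC; congr (_ + _); rewrite mulrC.
pose h (x : int * int) := (x.1 + x.2, x.1 - x.2).
have ih : injective h by move=> [a b] [a' b'] [] e1 e2; congr (_, _); lia.
(* The weight vanishes when k and n have opposite parity, so the map [h] need only reach pairs of
   equal parity. *)
have hs x : F x != 0 -> exists y, x = h y.
  case: x => k n; rewrite /F mulf_eq0 negb_or => /andP[/= H _].
  have E : (-1 : K) ^ (k - n) = 1.
    move: H; rewrite expfzDr ?oppr_eq0 ?oner_eq0 // signzN.
    have [->|->] := signz_cases k; have [->|->] := signz_cases n;
      by rewrite ?mul1r ?mulN1r ?opprK ?addNr ?subrr ?eqxx.
  have [m [Em|Em]] := int_parity (k - n).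
    exists (n + m, m); rewrite /h /= -(subrK n k) Em; congr (_, _); ring.
  move: E; rewrite Em signzS signz_double => /eqP.
  by rewrite eq_sym -subr_eq0 opprK (pnatr_eq0 _ 2).
rewrite (usum_reindex ih hs Fs) expr2 P (usumM Ps Ps) -usumZ; last exact: (asum_prod Ps Ps).
apply: eq_usum => -[a b]; rewrite /F /h /=.
rewrite !expfzDr ?oppr_eq0 ?oner_eq0 // signzN.
rewrite [LHS](_ : _ = 2 * ((-1) ^ a * (-1) ^ b) *
  q ^ ((3 * (a + b) + 1) * (3 * (a + b) + 1) + 9 * (a - b) * (a - b))).
  rewrite [RHS](_ : _ = 2 * ((-1) ^ a * (-1) ^ b) *
    (q ^ 1 * (q ^ (18 * a * a + 6 * a) * q ^ (18 * b * b + 6 * b)))).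
    by rewrite -!expfzDr //; congr (_ * _ ^ _); ring.
  by rewrite expr1z !expfzDr //; ring.
by rewrite !expfzDr //; ring.
Qed.

(** The change q -> -q exchanges [sum_sq0] with [sgn_sq0] and [sum_sq1] with minus [sgn_sq1]. In the
    difference the pure products cancel and each mixed product survives three times. *)
Lemma phi_odd :
  phi q * (sgn_sq0 q + sgn_sq1 q) - phi (- q) * (sgn_sq0 (- q) + sgn_sq1 (- q)) =
  6 * q * J 12 q ^+ 2.
Proof.
have nq0 : 0 < `|- q| by rewrite normrN.
have nq1 : `|- q| < 1 by rewrite normrN.
have e0 := sum_sq0N (- q); have e1 := sum_sq1N nq0 nq1; rewrite opprK in e0 e1.
rewrite !phi_mod3 // sum_sq0N sum_sq1N // -e0.
have -> : sgn_sq1 (- q) = - sum_sq1 q by rewrite e1 opprK.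
rewrite [RHS](_ : _ = 3 * (2 * q * J 12 q ^+ 2)); last by ring.
by rewrite -odd_product; ring.
Qed.

(** On the plane x + y + t = 1 the sum of squares is odd. *)
Lemma hexsum_odd : hexsum (- q) 1 = - hexsum q 1.
Proof.
rewrite -[RHS]mulN1r -usumZ; last exact: asum_hexsum.
apply: eq_usum => -[y t] /=; rewrite exprzN; congr (_ * _).
rewrite !expfzDr ?oppr_eq0 ?oner_eq0 // !signz_sq.
rewrite !expfzDr ?oppr_eq0 ?oner_eq0 // signzN expr1z.
by have [->|->] := signz_cases y; have [->|->] := signz_cases t; ring.
Qed.

End OddPart.

(** * The quadruple sum *)

Section TripleSum.
Context {R : realType}.
Local Notation K := R[i].
Variables (q : K) (q0 : 0 < `|q|) (q1 : `|q| < 1).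
Local Notation rp := (rqpoch (q ^+ 4)).

Let qn0 : q != 0. Proof. by rewrite -normr_gt0. Qed.
Let p0 : 0 < `|q ^+ 4|. Proof. by rewrite normrX exprn_gt0. Qed.
Let p1 : `|q ^+ 4| < 1. Proof. by rewrite normrX exprn_ilt1. Qed.

Definition Mexp (a b d i j k : int) : int :=
  i * i + 2 * j * j + 2 * k * k - 2 * i * j - 2 * j * k + 2 * a * i + 2 * b * j + 2 * d * k.

(** The quadratic part is (i - j)^2 + (j - k)^2 + k^2. Each square is bounded below with slope m,
    and T, the sum of the absolute values, satisfies S <= 3T; this m beats the linear terms and
    leaves S. *)
Lemma Mexp_ge (a b d i j k : int) (m : nat) :
  m = (3 * (2 * `|a| + 2 * `|b| + 2 * `|d| + 1))%N ->
  (`|i| + `|j| + `|k|)%N%:Z - (3 * m * m)%N%:Z <= Mexp a b d i j k.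
Proof.
set A := (2 * `|a| + 2 * `|b| + 2 * `|d|)%N => mE.
set S := (`|i| + `|j| + `|k|)%N; set T := (`|(i - j)%R| + `|(j - k)%R| + `|k|)%N.
have [ij jk] : (`|i| <= `|(i - j)%R| + `|j|)%N /\ (`|j| <= `|(j - k)%R| + `|k|)%N.
  by clear; lia.
have ST : (S <= 3 * T)%N by rewrite /S /T; move: ij jk; clear; lia.
have iS : (`|i| <= S)%N by rewrite /S -addnA leq_addr.
have jS : (`|j| <= S)%N by rewrite /S addnAC leq_addl.
have kS : (`|k| <= S)%N by rewrite /S leq_addl.
have hT : A%:Z * S%:Z + S%:Z <= m%:Z * T%:Z.
  rewrite (_ : _ + _ = (A%:Z + 1) * S%:Z) ?mE; last by rewrite mulrDl mul1r.
  rewrite (_ : _ * T%:Z = (A%:Z + 1) * (3 * T%:Z)); last by clear; lia.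
  by rewrite ler_wpM2l // -PoszM lez_nat.
have -> : Mexp a b d i j k = ((i - j) * (i - j) + (j - k) * (j - k) + k * k) +
  2 * (a * i + b * j + d * k) by rewrite /Mexp; ring.
have AS : A%:Z * S%:Z = 2 * (`|a|%N%:Z * S%:Z + `|b|%N%:Z * S%:Z + `|d|%N%:Z * S%:Z).
  by rewrite /A; clear; move: (S%:Z) => x; lia.
have E : m%:Z * T%:Z =
    m%:Z * `|(i - j)%R|%N%:Z + m%:Z * `|(j - k)%R|%N%:Z + m%:Z * `|k|%N%:Z.
  by rewrite /T !PoszD !mulrDr.
have -> : (3 * m * m)%N%:Z = 3 * (m%:Z * m%:Z) by clear; lia.
move: (mul_ge_linear a iS) (mul_ge_linear b jS) (mul_ge_linear d kS).
move: (sqr_ge_linear m (i - j)) (sqr_ge_linear m (j - k)) (sqr_ge_linear m k).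
rewrite E {}AS in hT; move: hT; clearbody S T A; clear - S m.
move: (m%:Z * m%:Z) (m%:Z * `|(i - j)%R|%N%:Z) (m%:Z * `|(j - k)%R|%N%:Z) (m%:Z * `|k|%N%:Z).
move: ((i - j) * (i - j)) ((j - k) * (j - k)) (k * k) (a * i) (b * j) (d * k).
move: (`|a|%N%:Z * S%:Z) (`|b|%N%:Z * S%:Z) (`|d|%N%:Z * S%:Z); clear; lia.
Qed.

Definition Mint (a b d : int) : K := usum (fun x : int * int * int =>
  q ^ (Mexp a b d x.1.1 x.1.2 x.2) * (rp x.1.1 * rp x.1.2 * rp x.2)).

Lemma asum_Mint a b d : asum (fun x : int * int * int =>
  q ^ (Mexp a b d x.1.1 x.1.2 x.2) * (rp x.1.1 * rp x.1.2 * rp x.2)).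
Proof.
have [e [e0 He]] := rp_bound p1.
apply: (@asum_exp _ _ (fun x => `|x.1.1| + `|x.1.2| + `|x.2|)%N _ (e * e * e)
  (3 * (3 * (2 * `|a| + 2 * `|b| + 2 * `|d| + 1)) *
    (3 * (2 * `|a| + 2 * `|b| + 2 * `|d| + 1)))%N) => //.
- by apply: asum_geom3 => //; exact: ltW.
- by move=> x _; exact: Mexp_ge.
- move=> x; rewrite !normrM; apply: ler_pM; rewrite ?mulr_ge0 //.
  exact: ler_pM.
Qed.

Lemma M_Mint a b d : M (q ^ (2 * a)) (q ^ (2 * b)) (q ^ (2 * d)) q = Mint a b d.
Proof.
pose h (x : nat * nat * nat) : int * int * int := (x.1.1%:Z, x.1.2%:Z, x.2%:Z).
have ih : injective h by move=> [[i j] k] [[i' j'] k'] [-> -> ->].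
rewrite /Mint (usum_reindex ih _ (asum_Mint a b d)) => [|[[i j] k] /=]; last first.
  rewrite !mulf_eq0 !negb_or => /andP[_ /andP[/andP[/rp_neq0 i0 /rp_neq0 j0] /rp_neq0 k0]].
  by exists (`|i|%N, `|j|%N, `|k|%N); rewrite /h /= !gez0_abs.
apply: eq_usum => -[[i j] k] /=.
rewrite !exprnP !exprz_exp -!expfzDr // -!invfM; congr (_ ^ _ / _).
by rewrite /Mexp; ring.
Qed.

End TripleSum.

Section QuadrupleSum.
Context {R : realType}.
Local Notation K := R[i].
Variables (q : K) (q0 : 0 < `|q|) (q1 : `|q| < 1).
Local Notation p := (q ^+ 4).
Local Notation rp := (rqpoch p).

Let qn0 : q != 0. Proof. by rewrite -normr_gt0. Qed.
Let p0 : 0 < `|p|. Proof. by rewrite normrX exprn_gt0. Qed.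
Let p1 : `|p| < 1. Proof. by rewrite normrX exprn_ilt1. Qed.
Let pE (a : int) : p ^ a = q ^ (4 * a). Proof. by rewrite exprnP exprz_exp. Qed.

Definition Nexp (u v w i j k l : int) : int :=
  4 * i * i + 4 * j * j + 2 * k * k + 2 * l * l - 4 * i * j - 4 * j * k - 2 * k * l
  + u * (i - j) + v * k + w * l.

(** Six times the quadratic part is 6(2i - j)^2 + 2(3j - 2k)^2 + (2k - 3l)^2 + 3l^2; the argument of
    [Mexp_ge] then applies with S <= 2T. *)
Lemma Nexp_ge (u v w i j k l : int) (m : nat) :
  m = (12 * (`|u| + `|v| + `|w| + 1))%N ->
  (`|i| + `|j| + `|k| + `|l|)%N%:Z - (2 * m * m)%N%:Z <= Nexp u v w i j k l.
Proof.
set A := (`|u| + `|v| + `|w|)%N => mE.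
set S := (`|i| + `|j| + `|k| + `|l|)%N.
set T := (6 * `|(2 * i - j)%R| + 2 * `|(3 * j - 2 * k)%R| + `|(2 * k - 3 * l)%R| + 3 * `|l|)%N.
have [ij [jk kl]] : (2 * `|i| <= `|(2 * i - j)%R| + `|j|)%N /\
    (3 * `|j| <= `|(3 * j - 2 * k)%R| + 2 * `|k|)%N /\
    (2 * `|k| <= `|(2 * k - 3 * l)%R| + 3 * `|l|)%N by clear; lia.
have ST : (S <= 2 * T)%N.
  rewrite /S /T; move: ij jk kl; clear.
  move: `|i|%N `|j|%N `|k|%N `|l|%N.
  move: `|(2 * i - j)%R|%N `|(3 * j - 2 * k)%R|%N `|(2 * k - 3 * l)%R|%N.
  by clear; lia.
have iS : (`|(i - j)%R| <= S)%N by rewrite /S; clear; lia.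
have kS : (`|k| <= S)%N by rewrite /S -addnA addnCA leq_addr.
have lS : (`|l| <= S)%N by rewrite /S leq_addl.
have hT : 6 * (A%:Z * S%:Z + S%:Z) <= m%:Z * T%:Z.
  rewrite (_ : _ * (_ + _) = (A%:Z + 1) * (6 * S%:Z)); last by clear; lia.
  rewrite mE (_ : _ * T%:Z = (A%:Z + 1) * (12 * T%:Z)); last by clear; lia.
  by rewrite ler_wpM2l //; move: ST; clear; lia.
have F : 6 * Nexp u v w i j k l = (6 * ((2 * i - j) * (2 * i - j)) +
   2 * ((3 * j - 2 * k) * (3 * j - 2 * k)) + (2 * k - 3 * l) * (2 * k - 3 * l) + 3 * (l * l)) +
  6 * (u * (i - j) + v * k + w * l) by rewrite /Nexp; ring.
have AS : A%:Z * S%:Z = `|u|%N%:Z * S%:Z + `|v|%N%:Z * S%:Z + `|w|%N%:Z * S%:Z.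
  by rewrite /A !PoszD !mulrDl.
have E : m%:Z * T%:Z = 6 * (m%:Z * `|(2 * i - j)%R|%N%:Z) +
    2 * (m%:Z * `|(3 * j - 2 * k)%R|%N%:Z) + m%:Z * `|(2 * k - 3 * l)%R|%N%:Z +
    3 * (m%:Z * `|l|%N%:Z).
  by rewrite /T; clear; lia.
have -> : (2 * m * m)%N%:Z = 2 * (m%:Z * m%:Z) by clear; lia.
move: (mul_ge_linear u iS) (mul_ge_linear v kS) (mul_ge_linear w lS).
move: (sqr_ge_linear m (2 * i - j)) (sqr_ge_linear m (3 * j - 2 * k)).
move: (sqr_ge_linear m (2 * k - 3 * l)) (sqr_ge_linear m l).
rewrite E {}AS in hT; move: hT F; clearbody S T A; clear - S m.
move: (m%:Z * m%:Z) (m%:Z * `|(2 * i - j)%R|%N%:Z) (m%:Z * `|(3 * j - 2 * k)%R|%N%:Z).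
move: (m%:Z * `|(2 * k - 3 * l)%R|%N%:Z) (m%:Z * `|l|%N%:Z) (Nexp u v w i j k l).
move: ((2 * i - j) * (2 * i - j)) ((3 * j - 2 * k) * (3 * j - 2 * k)).
move: ((2 * k - 3 * l) * (2 * k - 3 * l)) (l * l) (u * (i - j)) (v * k) (w * l).
move: (`|u|%N%:Z * S%:Z) (`|v|%N%:Z * S%:Z) (`|w|%N%:Z * S%:Z); clear; lia.
Qed.

(** The indices are grouped as ((k, l), (i, j)) so that the sum over i and j, the Durfee sum, is
    innermost. *)
Definition Nint (u v w : int) : K := usum (fun x : int * int * (int * int) =>
  q ^ (Nexp u v w x.2.1 x.2.2 x.1.1 x.1.2) * (rp x.2.1 * rp x.2.2 * rp x.1.1 * rp x.1.2)).

Lemma asum_Nint u v w : asum (fun x : int * int * (int * int) =>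
  q ^ (Nexp u v w x.2.1 x.2.2 x.1.1 x.1.2) * (rp x.2.1 * rp x.2.2 * rp x.1.1 * rp x.1.2)).
Proof.
have [e [e0 He]] := rp_bound p1.
apply: (@asum_exp _ _ (fun x => `|x.2.1| + `|x.2.2| + `|x.1.1| + `|x.1.2|)%N _ (e * e * e * e)
  (2 * (12 * (`|u| + `|v| + `|w| + 1)) * (12 * (`|u| + `|v| + `|w| + 1)))%N) => //.
- pose h (x : int * int * (int * int)) := (x.2.1, x.2.2, x.1.1, x.1.2).
  have ih : injective h by move=> [[k l] [i j]] [[k' l'] [i' j']] [-> -> -> ->].
  exact: (asum_comp ih (asum_geom4 (ltW q0) q1)).
- by move=> x _; exact: Nexp_ge.
- move=> x; rewrite !normrM; apply: ler_pM; rewrite ?mulr_ge0 //.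
  by apply: ler_pM; rewrite ?mulr_ge0 //; exact: ler_pM.
Qed.

Lemma N_Nint u v w : N (q ^ u) (q ^ v) (q ^ w) (q ^+ 2) = Nint u v w.
Proof.
pose h (x : nat * nat * nat * nat) : int * int * (int * int) :=
  ((x.1.2%:Z, x.2%:Z), (x.1.1.1%:Z, x.1.1.2%:Z)).
have ih : injective h by move=> [[[i j] k] l] [[[i' j'] k'] l'] [-> -> -> ->].
rewrite /Nint (usum_reindex ih _ (asum_Nint u v w)) => [|[[k l] [i j]] /=]; last first.
  rewrite !mulf_eq0 !negb_or => /andP[_].
  move=> /andP[/andP[/andP[/rp_neq0 i0 /rp_neq0 j0] /rp_neq0 k0] /rp_neq0 l0].
  by exists (`|i|%N, `|j|%N, `|k|%N, `|l|%N); rewrite /h /= !gez0_abs.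
apply: eq_usum => -[[[i j] k] l] /=.
rewrite -[(q ^+ 2) ^+ 2]exprM !exprnP !exprz_exp -!expfzDr // -!invfM; congr (_ ^ _ / _).
by rewrite /Nexp; ring.
Qed.

Let Dexp (u v w k l m n : int) := 4 * m * m + u * m + 2 * k * k + 2 * l * l - 2 * k * l +
  v * k + w * l + 4 * (m * n - n * (k - n)).

Let D u v w (x : int * int * (int * int)) : K :=
  q ^ (Dexp u v w x.1.1 x.1.2 x.2.1 x.2.2) * (rp x.1.2 * (rp x.2.2 * rp (x.1.1 - x.2.2))).

(** With m = i - j and b = j, the sum over b for fixed k, l, m is the left side of
    [durfee_binomial], the factor [rp k] included; n is the new index on its right side. *)
Let Nint_D u v w : asum (D u v w) -> Nint u v w = durfee p 0 * usum (D u v w).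
Proof.
move=> Ds.
pose F (x : int * int * (int * int)) : K :=
  q ^ (Nexp u v w x.2.1 x.2.2 x.1.1 x.1.2) * (rp x.2.1 * rp x.2.2 * rp x.1.1 * rp x.1.2).
have Fs : asum F by exact: asum_Nint.
pose h (x : int * int * (int * int)) := (x.1, (x.2.2 + x.2.1, x.2.2)).
pose h' (x : int * int * (int * int)) := (x.1, (x.2.1 - x.2.2, x.2.2)).
have hK : cancel h h'.
  by move=> [y [m b]]; rewrite /h /h' /=; congr (_, (_, _)); rewrite addrC addKr.
have h'K : cancel h' h by move=> [y [i j]]; rewrite /h /h' /=; congr (_, (_, _)); ring.
have Fhs : asum (fun x => F (h x)) by apply: asum_comp Fs; exact: can_inj hK.
have -> : Nint u v w = usum F by [].
rewrite (usum_bij hK h'K Fhs) (usum_fubini Fhs) (usum_fubini Ds).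
rewrite -usumZ; last exact: (asum_usum Ds).
apply: eq_usum => -[k l].
rewrite (usum_fubini (asum_row (k, l) Fhs)) (usum_fubini (asum_row (k, l) Ds)).
rewrite -usumZ; last exact: (asum_usum (asum_row (k, l) Ds)).
apply: eq_usum => m.
pose e := 4 * m * m + u * m + 2 * k * k + 2 * l * l - 2 * k * l + v * k + w * l.
have FE b : F (h (k, l, (m, b))) = q ^ e * rp l * rp k *
    (p ^ (b * (b + m) - b * k) * (rp b * rp (b + m))).
  rewrite /F /h /= pE (_ : Nexp _ _ _ _ _ _ _ = e + 4 * (b * (b + m) - b * k)); last first.
    by rewrite /Nexp /e; ring.
  rewrite expfzDr //; ring.
have DE n : D u v w (k, l, (m, n)) =
    q ^ e * rp l * (p ^ (m * n - n * (k - n)) * (rp n * rp (k - n))).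
  rewrite /D /= pE (_ : Dexp _ _ _ _ _ _ _ = e + 4 * (m * n - n * (k - n))); last first.
    by rewrite /Dexp /e; ring.
  rewrite expfzDr //; ring.
rewrite (eq_usum FE) (eq_usum DE) usumZ; last exact: asum_durfee.
rewrite usumZ; last exact: asum_binomial.
rewrite -[LHS]mulrA [X in _ * X = _](durfee_binomial p0 p1 m k); exact: mulrCA.
Qed.

(** Averaging over q and -q inserts the weight (1 + (-1)^(z+i+c))/2, where z is the index of phi,
    since the total exponent has the parity of z + i. On the support z = 2m + i - c, and the shift
    by c completes the square with the linear term -4cm; the extra c in d + c compensates the cross
    term. *)
Lemma Nint_phi_Mint (c b d : int) :
  Nint (- (4 * c)) (2 * d) (2 * b) = durfee p 0 * q ^ (- (c * c)) *
    ((phi q * Mint q (d + c) b d + (-1) ^ c * (phi (- q) * Mint (- q) (d + c) b d)) / 2).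
Proof.
set u := - (4 * c); set v := 2 * d; set w := 2 * b; set a := d + c.
have sn : (-1 : K) != 0 by rewrite oppr_eq0 oner_eq0.
have nq0 : 0 < `|- q| by rewrite normrN.
have nq1 : `|- q| < 1 by rewrite normrN.
have phis (x : K) : 0 < `|x| -> `|x| < 1 -> asum (fun n : int => x ^ (n ^+ 2)).
  move=> x0 x1.
  apply: (@asum_exp1 _ _ x0 x1 _ (fun x => `|x|)%N 0).
    by apply: asum_geom => //; exact: ltW.
  by move=> n; rewrite subr0 expr2; exact: absz_le_sqr.
pose G (x : int * (int * int * int)) : K := (1 + (-1) ^ (x.1 + x.2.1.1 + c)) / 2 *
  (q ^ (x.1 * x.1 + Mexp a b d x.2.1.1 x.2.1.2 x.2.2) * (rp x.2.1.1 * rp x.2.1.2 * rp x.2.2)).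
have B1 := asum_prod (phis q q0 q1) (asum_Mint q0 q1 a b d).
have B2 := asum_prod (phis _ nq0 nq1) (asum_Mint nq0 nq1 a b d).
have GE x : G x = 2^-1 * (q ^ (x.1 ^+ 2) * (q ^ (Mexp a b d x.2.1.1 x.2.1.2 x.2.2) *
      (rp x.2.1.1 * rp x.2.1.2 * rp x.2.2))) +
    2^-1 * (-1) ^ c * ((- q) ^ (x.1 ^+ 2) * ((- q) ^ (Mexp a b d x.2.1.1 x.2.1.2 x.2.2) *
      (rqpoch ((- q) ^+ 4) x.2.1.1 * rqpoch ((- q) ^+ 4) x.2.1.2 * rqpoch ((- q) ^+ 4) x.2.2))).
  case: x => z [[i j] k]; rewrite /G /=.
  have -> : (- q) ^+ 4 = q ^+ 4 by rewrite -mulN1r exprMn -signr_odd expr0 mul1r.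
  rewrite !(exprzN q) expr2 signz_sq.
  have -> : (-1 : K) ^ (Mexp a b d i j k) = (-1) ^ i.
    rewrite (_ : Mexp _ _ _ _ _ _ =
      i * i + 2 * (j * j + k * k - i * j - j * k + a * i + b * j + d * k)).
      by rewrite expfzDr // signz_double mulr1 signz_sq.
    by rewrite /Mexp; ring.
  rewrite !(@expfzDr _ (-1)) // (@expfzDr _ q (z * z)) //; ring.
have Gs : asum G.
  by apply: eq_asum (asumD (asumZ 2^-1 B1) (asumZ (2^-1 * (-1) ^ c) B2)) => x; rewrite GE.
have -> : (phi q * Mint q a b d + (-1) ^ c * (phi (- q) * Mint (- q) a b d)) / 2 = usum G.
  rewrite (eq_usum GE) usumD; [|exact: asumZ B1|exact: asumZ B2].
  rewrite (usumZ _ B1) (usumZ _ B2) -(usumM (phis q q0 q1) (asum_Mint q0 q1 a b d)).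
  rewrite -(usumM (phis _ nq0 nq1) (asum_Mint nq0 nq1 a b d)) mulrDl.
  by congr (_ + _); rewrite mulrC // mulrA.
(* The indices of M are i = n, j = l and k - n, in terms of the indices k, l, m, n of [D]. *)
pose h (x : int * int * (int * int)) : int * (int * int * int) :=
  (x.2.2 + 2 * x.2.1 - c, (x.2.2, x.1.2, x.1.1 - x.2.2)).
have ih : injective h.
  move=> [[k l] [m n]] [[k' l'] [m' n']] [] e1 e2 e3 e4; clear - e1 e2 e3 e4.
  by congr (_, _, (_, _)); lia.
have hs x : G x != 0 -> exists y, x = h y.
  case: x => z [[i j] k]; rewrite /G mulf_eq0 negb_or => /andP[/= H _].
  have [m [Em|Em]] := int_parity (z - i + c).
    exists ((i + k, j), (m, i)); rewrite /h /= -Em; congr (_, (_, _, _)); ring.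
  move: H; rewrite (_ : z + i + c = (z - i + c) + 2 * i); last by ring.
  rewrite Em (_ : 2 * m + 1 + 2 * i = 2 * (m + i) + 1); last by ring.
  by rewrite signzS signz_double subrr mul0r eqxx.
rewrite (usum_reindex ih hs Gs).
have DE x : D u v w x = q ^ (- (c * c)) * G (h x).
  case: x => [[k l] [m n]]; rewrite /D /G /h /=.
  rewrite (_ : n + 2 * m - c + n + c = 2 * (n + m)); last by ring.
  rewrite signz_double (_ : (1 + 1) / 2 = 1); last by rewrite divff ?pnatr_eq0.
  rewrite mul1r [RHS]mulrA -expfzDr //.
  rewrite (_ : - (c * c) + _ = Dexp u v w k l m n); first by congr (_ * _); rewrite mulrCA mulrA.
  by rewrite /Dexp /Mexp /u /v /w /a; ring.
have Ghs : asum (fun x => G (h x)) by exact: asum_comp ih Gs.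
have Ds : asum (D u v w) by apply: eq_asum (asumZ (q ^ (- (c * c))) Ghs) => x; rewrite DE.
by rewrite (Nint_D Ds) (eq_usum DE) (usumZ _ Ghs) mulrA.
Qed.

(** Raising i by one in the cubic theta sum turns rp (i - 1) into rp i and adds 1 to
    [Mexp 1 (-1) 0], hence the factor q. *)
Lemma Mint_product : q * Mint q 1 (-1) 0 =
  durfee p 0 ^+ 3 * (hexsum q 1 * (sgn_sq0 q + sgn_sq1 q)).
Proof.
rewrite -cube_theta_schur_seq // -usum_cube_theta //.
rewrite -usumZ; last exact: asum_Mint.
pose h (x : int * int * int) := (x.1.1 + 1, x.1.2, x.2).
pose h' (x : int * int * int) := (x.1.1 - 1, x.1.2, x.2).
have hK : cancel h h' by move=> [[i j] k]; rewrite /h /h' /= addrK.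
have h'K : cancel h' h by move=> [[i j] k]; rewrite /h /h' /= subrK.
have E i j k : q ^ ((i + 1 - j) * (i + 1 - j) + (j - k) * (j - k) + k * k) =
    q * q ^ (Mexp 1 (-1) 0 i j k).
  have -> : (i + 1 - j) * (i + 1 - j) + (j - k) * (j - k) + k * k =
    1 + Mexp 1 (-1) 0 i j k by rewrite /Mexp; ring.
  by rewrite (expfzDr 1) // expr1z.
rewrite [RHS](usum_bij hK h'K); last first.
  apply: eq_asum (asumZ q (asum_Mint q0 q1 1 (-1) 0)) => -[[i j] k].
  by rewrite /h /= E addrK !mulrA.
by apply: eq_usum => -[[i j] k]; rewrite /h /= E addrK !mulrA.
Qed.

End QuadrupleSum.

(** * The two-term formulas and the product evaluation *)

Unset Implicit Arguments.
Set Strict Implicit.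

(** The field computation behind [N2_product]. Since h is odd, as is the prefactor s, both values of
    M carry the common factor h / (s j4^3), leaving the odd part of the theta product. *)
Lemma two_term_algebra (K : numFieldType) (s f1 f2 m1 m2 h u1 u2 j2 j4 j6 j12 : K) :
  s != 0 -> j2 != 0 -> j4 != 0 ->
  s * m1 = j4^-1 ^+ 3 * (h * u1) -> - s * m2 = j4^-1 ^+ 3 * (- h * u2) ->
  h * j2 = 3 * s * j6 ^+ 3 -> f1 * u1 - f2 * u2 = 6 * s * j12 ^+ 2 ->
  1 / 2 * (s^-1 / j4) * (f1 * m1 - (-1) ^+ 2 * f2 * m2) =
  9 * (j6 ^+ 3 * j12 ^+ 2) / (j2 * j4 ^+ 4).
Proof.
move=> s0 j20 j40 E1 E2 E3 E4.
have -> : m1 = s^-1 * (j4^-1 ^+ 3 * (h * u1)) by rewrite -E1 mulKf.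
have -> : m2 = s^-1 * (j4^-1 ^+ 3 * (h * u2)).
  by apply: (mulfI s0); rewrite mulVKf // -[LHS]opprK -mulNr E2; ring.
have Eh : h = 3 * s * j6 ^+ 3 / j2 by exact: (canRL (mulfK j20) E3).
rewrite [LHS](_ : _ = 1 / 2 * (s^-1 / j4) * s^-1 * j4^-1 ^+ 3 * h * (f1 * u1 - f2 * u2)).
  by rewrite E4 Eh; field; rewrite s0 j20 j40.
by ring.
Qed.

Section Assembly.
Context {R : realType}.
Local Notation K := R[i].

Lemma durfee0E (q : K) : 0 < `|q| -> `|q| < 1 -> durfee (q ^+ 4) 0 = (J 4 q)^-1.
Proof.
move=> q0 q1.
have q20 : 0 < `|q ^+ 2| by rewrite normrX exprn_gt0.
have q21 : `|q ^+ 2| < 1 by rewrite normrX exprn_ilt1.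
have := durfee0_qpoch_inf q20 q21; rewrite -exprM -/(J 4 q) => H.
by apply: (mulIf (qpoch_inf_neq0 q20 q21)); rewrite -exprM -/(J 4 q) H mulVf //;
  have := qpoch_inf_neq0 q20 q21; rewrite -exprM.
Qed.

Lemma Nint_two_term (q : K) (m b d : int) : 0 < `|q| -> `|q| < 1 ->
  Nint q (- (4 * m)) (2 * d) (2 * b) = 1 / 2 * (q ^ (- (m * m)) / J 4 q) *
    (phi q * Mint q (d + m) b d - (-1) ^ (m + 1) * phi (- q) * Mint (- q) (d + m) b d).
Proof.
move=> q0 q1; rewrite Nint_phi_Mint // durfee0E // signzS.
move: (phi q) (phi (- q)) (Mint q _ _ _) (Mint (- q) _ _ _) (J 4 q)^-1 (q ^ _) ((-1) ^ m).
by move=> x y M1 M2 j e g; field.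
Qed.

(** The parameters (m, b, d) for h = 1, 2, 3, 4 are (0,0,0), (1,-1,0), (2,0,-1) and (1,0,0), so that
    c_h = -m^2. *)
Lemma Nh_two_term (q : K) (h : nat) : 0 < `|q| -> `|q| < 1 -> (1 <= h <= 4)%N ->
  Nh h (q ^+ 2) = 1 / 2 * (q ^ c h / J 4 q)
       * (phi q * Mh h q - (-1) ^+ h * phi (- q) * Mh h (- q)).
Proof.
move=> q0 q1.
have nq0 : 0 < `|- q| by rewrite normrN.
have nq1 : `|- q| < 1 by rewrite normrN.
have e1 : q ^- 2 = q ^ (-2) by [].
have e2 : (q ^+ 2) ^- 2 = q ^ (-4) by rewrite -exprM exprnN.
have e3 : (q ^+ 2) ^- 4 = q ^ (-8) by rewrite -exprM exprnN.
have sq : (- q) ^+ 2 = q ^+ 2 by rewrite sqrrN.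
case: h => [|[|[|[|[|h]]]]] // _; rewrite /Nh /Mh ?e1 ?e2 ?e3.
- rewrite (N_Nint q0 q1 0 0 0) (M_Mint q0 q1 0 0 0) (M_Mint nq0 nq1 0 0 0).
  exact: (Nint_two_term q 0 0 0).
- rewrite (N_Nint q0 q1 (-4) 0 (-2)) (M_Mint q0 q1 1 (-1) 0) (M_Mint nq0 nq1 1 (-1) 0).
  exact: (Nint_two_term q 1 (-1) 0).
- rewrite (N_Nint q0 q1 (-8) (-2) 0) (M_Mint q0 q1 1 0 (-1)) (M_Mint nq0 nq1 1 0 (-1)).
  exact: (Nint_two_term q 2 0 (-1)).
- rewrite (N_Nint q0 q1 (-4) 0 0) (M_Mint q0 q1 1 0 0) (M_Mint nq0 nq1 1 0 0).
  (* For h = 4 the general formula has the sign (-1)^(m+1) with m = 1; only the parity of h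
     matters. *)
  rewrite (_ : (-1) ^+ 4 = (-1) ^+ 2); last by rewrite -signr_odd -[RHS]signr_odd.
  exact: (Nint_two_term q 1 0 0).
Qed.

Lemma JX (q : K) (m : nat) : J m (q ^+ 2) = J (2 * m) q.
Proof. by rewrite /J -!exprM. Qed.

Lemma N2_product (s : K) : 0 < `|s| -> `|s| < 1 ->
  Nh 2 (s ^+ 2) = 9 * (J 6 s ^+ 3 * J 12 s ^+ 2) / (J 2 s * J 4 s ^+ 4).
Proof.
move=> s0 s1; rewrite Nh_two_term //.
have ns0 : 0 < `|- s| by rewrite normrN.
have ns1 : `|- s| < 1 by rewrite normrN.
have sn0 : s != 0 by rewrite -normr_gt0.
have s20 : 0 < `|s ^+ 2| by rewrite normrX exprn_gt0.
have s21 : `|s ^+ 2| < 1 by rewrite normrX exprn_ilt1.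
have J2 : J 2 s != 0 by exact: qpoch_inf_neq0.
have J4 : J 4 s != 0 by have := qpoch_inf_neq0 s20 s21; rewrite -exprM.
have J4N : J 4 (- s) = J 4 s.
  by rewrite /J (_ : (- s) ^+ 4 = s ^+ 4) // -mulN1r exprMn -signr_odd expr0 mul1r.
have M1 : Mh 2 s = Mint s 1 (-1) 0 by exact: (M_Mint s0 s1 1 (-1) 0).
have M2 : Mh 2 (- s) = Mint (- s) 1 (-1) 0 by exact: (M_Mint ns0 ns1 1 (-1) 0).
have P1 := Mint_product s0 s1; have P2 := Mint_product ns0 ns1.
rewrite -M1 (durfee0E s s0 s1) in P1.
rewrite -M2 (durfee0E (- s) ns0 ns1) J4N (hexsum_odd s0 s1) in P2.
have H := hexsum_product s0 s1; have O := phi_odd s0 s1.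
have -> : s ^ c 2 = s^-1 by [].
exact: two_term_algebra sn0 J2 J4 P1 P2 H O.
Qed.

End Assembly.

Theorem theorem1p7 (R : realType) (q : R[i]) (hq0 : 0 < `|q|) (hq1 : `|q| < 1) :
  (forall h : nat, (1 <= h <= 4)%N ->
     Nh h (q ^+ 2) =
       1 / 2 * (q ^ c h / J 4 q)
       * (phi q * Mh h q - (-1) ^+ h * phi (- q) * Mh h (- q)))
  /\
  usum (fun t : nat * nat * nat * nat => let: (i, j, k, l) := t in
    q ^ (2 * i%:Z ^+ 2 + 2 * j%:Z ^+ 2 + k%:Z ^+ 2 + l%:Z ^+ 2
         - 2 * i%:Z * j%:Z - 2 * j%:Z * k%:Z - k%:Z * l%:Z
         - 2 * i%:Z + 2 * j%:Z - l%:Z)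
    / (qpoch (q ^+ 2) (q ^+ 2) i * qpoch (q ^+ 2) (q ^+ 2) j
       * qpoch (q ^+ 2) (q ^+ 2) k * qpoch (q ^+ 2) (q ^+ 2) l))
  = 9 * (J 3 q ^+ 3 * J 6 q ^+ 2) / (J 1 q * J 2 q ^+ 4).
Proof.
split; first by move=> h; exact: Nh_two_term.
have qn0 : q != 0 by rewrite -normr_gt0.
(* [N2_product] evaluates N^(2) at a square, so it is applied to a complex square root of q. *)
have [s sq] : exists s : R[i], s ^+ 2 = q by exists (sqrtc q); exact: sqr_sqrtc.
have s0 : 0 < `|s|.
  by rewrite normr_gt0; apply: contraNneq qn0 => s0; rewrite -sq s0 expr0n.
have s1 : `|s| < 1 by rewrite -(@expr_lt1 _ 2) // -normrX sq.
have := N2_product _ s0 s1; rewrite sq.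
have E m : J (2 * m) s = J m q by rewrite -sq JX.
rewrite (E 3) (E 6) (E 1%N) (E 2%N) => <-.
(* The remaining sum is N^(2)(q), with u = q^(-2), v = 1 and w = q^(-1) absorbed into the
   exponent. *)
rewrite /Nh /N; apply: eq_usum => -[[[i j] k] l].
have -> : (q ^- 2) ^ (i%:Z - j%:Z) = q ^ (-2 * (i%:Z - j%:Z)).
  by rewrite (_ : q ^- 2 = q ^ (-2)) // exprz_exp.
have -> : q^-1 ^+ l = q ^ (- l%:Z) by rewrite exprVn exprnN.
by rewrite expr1n mulr1 -!expfzDr //; congr (_ ^ _ / _); ring.
Qed.
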